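(* Let $G$ and $H$ be finite abelian groups and $e$ the exponent of $G$. Let $F$ be a field such that $\operatorname{char}(F)\nmid|G|$ and such that, whenever $p^n$ is a prime power dividing $e$ for which $F$ contains no primitive $p^n$-th root of unity, and $\zeta$ is a primitive $p^n$-th root of unity in an extension field of $F$, the field $F(\zeta)$ contains no primitive $p^{n+1}$-th root of unity. Then $G\sim_F H$ implies $G\cong H$.
   Context: For a field $F$ and finite group $G$, $H^2(G,F^* )$ is the second cohomology group with trivial action; for $\alpha\in Z^2(G,F^* )$ the twisted group algebra $F^\alpha G$ has $F$-basis $\{u_g\}$, $F$ central, $u_gu_h=\alpha(g,h)u_{gh}$. $G\sim_F H$ means there is a group isomorphism $\psi:H^2(G,F^* )\to H^2(H,F^* )$ with $F^\alpha G\cong F^{\psi(\alpha)}H$ as rings for all $[\alpha]\in H^2(G,F^* )$. *)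

(* Defs.v *)
From HB Require Import structures.
From mathcomp Require Import all_boot all_order all_algebra all_fingroup all_solvable all_field.
Set Implicit Arguments. Unset Strict Implicit. Unset Printing Implicit Defensive.
Import GRing.Theory.
Local Open Scope ring_scope.

Section TwistedGroupAlgebras.
Variable F : fieldType.

Definition cocycle (gT : finGroupType) (alpha : gT -> gT -> F) : Prop :=
  (forall g h, alpha g h != 0) /\
  (forall g h k, alpha g h * alpha (g * h)%g k = alpha h k * alpha g (h * k)%g).

Definition cohom (gT : finGroupType) (alpha alpha' : gT -> gT -> F) : Prop :=
  exists beta : gT -> F, (forall g, beta g != 0) /\
    (forall g h, alpha' g h = alpha g h * beta g * beta h / beta (g * h)%g).

Definition cmul (gT : finGroupType) (a b : gT -> gT -> F) : gT -> gT -> F :=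
  fun g h => a g h * b g h.

(* Twisted group algebra F^alpha G: elements sum_g x(g) u_g are coefficient
   functions x : {ffun gT -> F}; addition is pointwise and
   (sum x_g u_g)(sum y_h u_h) = sum_{g,h} x_g y_h alpha(g,h) u_{gh}. *)
Definition tga_mul (gT : finGroupType) (alpha : gT -> gT -> F)
    (x y : {ffun gT -> F}) : {ffun gT -> F} :=
  [ffun k => \sum_(g : gT) \sum_(h : gT | (g * h)%g == k) x g * y h * alpha g h].

(* ring isomorphism F^alpha G ~= F^beta H (a bijective additive and
   multiplicative map; it then automatically preserves 1) *)
Definition tga_iso (gT hT : finGroupType) (alpha : gT -> gT -> F)
    (beta : hT -> hT -> F) : Prop :=
  exists f : {ffun gT -> F} -> {ffun hT -> F},
    [/\ bijective f,
        forall x y, f (x + y) = f x + f y &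
        forall x y, f (tga_mul alpha x y) = tga_mul beta (f x) (f y)].

(* G ~_F H : a group isomorphism psi : H^2(G,F^* ) -> H^2(H,F^* ), given on
   representatives, with F^alpha G ~= F^psi(alpha) H for all classes. *)
Definition sim_F (gT hT : finGroupType) : Prop :=
  exists psi : (gT -> gT -> F) -> (hT -> hT -> F),
    [/\ forall a, cocycle a -> cocycle (psi a),
        forall a b, cocycle a -> cocycle b -> cohom a b -> cohom (psi a) (psi b),
        forall a b, cocycle a -> cocycle b ->
          cohom (psi (cmul a b)) (cmul (psi a) (psi b)),
        forall a b, cocycle a -> cocycle b -> cohom (psi a) (psi b) -> cohom a b &
        forall c, cocycle c -> exists2 a, cocycle a & cohom (psi a) c] /\
    (forall a, cocycle a -> tga_iso a (psi a)).

End TwistedGroupAlgebras.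

(* Main.v *)
(* From F^1 G = F^psi(1) H one gets a ring isomorphism FG = FH. Let L = F(z) with
   z a primitive root of unity of large order N. A component of FG embeds in L
   with image generated over F by the roots of unity which the component contains;
   hence the ring isomorphism preserves the F-dimension of components, although it
   need not be F-linear. For a subfield E of L, the roots of unity z^i in E are those
   with z^(iD) = 1 for some D, and the components whose group elements lie in E
   fill an ideal of dimension #{g | g^D = 1}, so G and H agree on this number. With
   mu_l the number of invariants of G divisible by p^(l+1), taking E = L,
   E = F and E = F(zeta_(p^k)) determines all mu_l except the individual mu_l with
   zeta_(p^(l+1)) in F, of which one gets the sum.
   For those, u_g u_h = c(g,h) u_h u_g defines an alternating bicharacter c which is
   trivial iff the twisted group algebra is commutative. Hence psi induces a bijection
   between the alternating bicharacters of G and of H with values in F; counting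
   those with values in the p^k-th roots of unity gives the binomials (mu_l choose 2),
   which determine mu_l up to exchanging 0 and 1, and the sum settles this. *)
Require Import Defs.
From HB Require Import structures.
From mathcomp Require Import all_boot all_order all_algebra all_fingroup all_solvable all_field.
From mathcomp Require Import ring zify.
From Stdlib Require Import Classical.
Set Implicit Arguments. Unset Strict Implicit. Unset Printing Implicit Defensive.
Import GRing.Theory.
Local Open Scope ring_scope.

(** * The group algebra of an abelian group *)

Section GroupAlgebra.
Variables (F : fieldType) (gT : finGroupType).

Lemma tga_mulE (a : gT -> gT -> F) (x y : {ffun gT -> F}) k :
  tga_mul a x y k = \sum_g x g * y (g^-1 * k)%g * a g (g^-1 * k)%g.
Proof.
rewrite ffunE; apply: eq_bigr => g _.
rewrite (big_pred1 (g^-1 * k)%g) // => h.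
by apply/eqP/eqP => [<-|->]; rewrite ?mulKg ?mulKVg.
Qed.

Definition gunit (g : gT) : {ffun gT -> F} := [ffun h => (h == g)%:R].

Lemma tga_gunit (a : gT -> gT -> F) g h k :
  tga_mul a (gunit g) (gunit h) k = a g h *+ (k == g * h)%g.
Proof.
rewrite tga_mulE (bigD1 g) //= big1 ?addr0 => [|u /negPf ug]; last first.
  by rewrite ffunE ug !mul0r.
rewrite !ffunE eqxx mul1r; have [->|kgh] := eqVneq k (g * h)%g.
  by rewrite mulKg eqxx mul1r.
have /negPf-> : (g^-1 * k)%g != h by apply: contraNneq kgh => <-; rewrite mulKVg.
by rewrite mul0r.
Qed.

(* The commutativity proof is a parameter of the type so that the ring
   structure can be declared commutative. *)
Definition galg (_ : abelian [set: gT]) : Type := {ffun gT -> F}.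

Variable cG : abelian [set: gT].
Local Notation A := (galg cG).

HB.instance Definition _ := Vector.copy A {ffun gT -> F^o}.

Definition galg_one : A := gunit 1%g.
Definition galg_mul : A -> A -> A := tga_mul (fun _ _ => 1).

Lemma galg_mulE (x y : A) k : galg_mul x y k = \sum_g x g * y (g^-1 * k)%g.
Proof. by rewrite /galg_mul tga_mulE; apply: eq_bigr => g _; rewrite mulr1. Qed.

Lemma mulgC_setT (g h : gT) : (g * h = h * g)%g.
Proof. by apply: (centsP cG); rewrite inE. Qed.

Lemma galg_mulC : commutative galg_mul.
Proof.
move=> x y; apply/ffunP => k; rewrite !galg_mulE.
rewrite (reindex_inj (inj_comp (mulgI k) invg_inj)) /=; apply: eq_bigr => g _.
by rewrite mulrC invMg invgK mulgKV mulgC_setT.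
Qed.

Lemma galg_mulA : associative galg_mul.
Proof.
move=> x y z; apply/ffunP => k; rewrite !galg_mulE.
under eq_bigr => g _ do rewrite galg_mulE mulr_sumr.
under [RHS]eq_bigr => g _ do rewrite galg_mulE mulr_suml.
rewrite [RHS]exchange_big /=; apply: eq_bigr => g _.
rewrite [RHS](reindex_inj (mulgI g)) /=; apply: eq_bigr => h _.
by rewrite mulKg mulrA invMg mulgA.
Qed.

Lemma galg_mul1 : left_id galg_one galg_mul.
Proof.
move=> x; apply/ffunP => k; rewrite galg_mulE (bigD1 1%g) //= big1.
  by rewrite ffunE eqxx mul1r invg1 mul1g addr0.
by move=> g /negPf g1; rewrite ffunE g1 mul0r.
Qed.

Lemma galg_mulDl : left_distributive galg_mul +%R.
Proof.
move=> x y z; apply/ffunP => k; rewrite !(galg_mulE, ffunE) -big_split /=.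
by apply: eq_bigr => g _; rewrite ffunE mulrDl.
Qed.

Lemma galg_one_neq0 : galg_one != 0.
Proof.
by apply/eqP => /ffunP/(_ 1%g)/eqP; rewrite !ffunE eqxx oner_eq0.
Qed.

HB.instance Definition _ := GRing.Zmodule_isComNzRing.Build A
  galg_mulA galg_mulC galg_mul1 galg_mulDl galg_one_neq0.

Lemma galg_scaleAl (c : F) (x y : A) : c *: (x * y) = (c *: x) * y.
Proof.
apply/ffunP => k; rewrite ffunE [(x * y) k]galg_mulE [RHS]galg_mulE.
rewrite [LHS]mulr_sumr; apply: eq_bigr => g _; rewrite ffunE.
exact: mulrA.
Qed.

HB.instance Definition _ := GRing.Lmodule_isLalgebra.Build F A galg_scaleAl.
HB.instance Definition _ := GRing.Lalgebra_isComAlgebra.Build F A.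

Definition gal_mull (a x : A) := a * x.
Lemma gal_mull_linear a : linear (gal_mull a).
Proof. by move=> c x y; rewrite /gal_mull mulrDr scalerAr. Qed.
HB.instance Definition _ a := GRing.isLinear.Build F A A _ (gal_mull a) (gal_mull_linear a).
End GroupAlgebra.

(** * Ideals and evaluation at characters *)

Section Ideals.
Variables (F : fieldType) (gT : finGroupType) (cG : abelian [set: gT]).
Local Notation A := (galg F cG).
Implicit Types (a b e u x y : A).

Definition gal_ideal a : {vspace A} := limg (linfun (gal_mull a)).

Lemma gal_idealP a x : reflect (exists y, x = a * y) (x \in gal_ideal a).
Proof.
apply: (iffP memv_imgP) => [[y _ ->]|[y ->]]; exists y; rewrite ?lfunE //.
exact: memvf.
Qed.

Lemma gal_ideal_idem e x : e * e = e -> (x \in gal_ideal e) = (e * x == x).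
Proof.
move=> ee; apply/gal_idealP/eqP => [[y ->]|<-]; last by exists x.
by rewrite mulrA ee.
Qed.

(** [u] and [e - u] are orthogonal idempotents with sum [e], so [e A] is the direct sum of [u A] and
    [(e - u) A]. *)
Lemma gal_ideal_dimD e u : e * e = e -> u * u = u -> u * e = u ->
  \dim (gal_ideal e) = (\dim (gal_ideal u) + \dim (gal_ideal (e - u)%R))%N.
Proof.
move=> ee uu ue; have vv : (e - u) * (e - u) = e - u.
  by rewrite mulrBl !mulrBr ee [e * u]mulrC ue uu subrr subr0.
rewrite -dimv_disjoint_sum; last first.
  apply/eqP; rewrite -subv0; apply/subvP => x.
  rewrite memv_cap !gal_ideal_idem // memv0 => /andP[/eqP xu /eqP xv].
  by rewrite -xv -xu mulrA mulrBl uu [e * u]mulrC ue subrr mul0r.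
congr (\dim _); apply/eqP; rewrite eqEsubv; apply/andP; split; apply/subvP => x.
  rewrite gal_ideal_idem // => /eqP <-; rewrite -[e in e * x](subrK u) addrC mulrDl.
  by apply: memv_add; rewrite gal_ideal_idem // mulrA ?uu ?vv.
case/memv_addP => y + [z + ->]; rewrite !gal_ideal_idem // => /eqP <- /eqP <-.
by rewrite mulrDr !mulrA [e * u]mulrC ue mulrBr ee [e * u]mulrC ue.
Qed.

Lemma gal_ideal_gt0 e : e * e = e -> e != 0 -> (0 < \dim (gal_ideal e))%N.
Proof.
move=> ee e0; rewrite lt0n dimv_eq0; apply: contraNneq e0 => i0.
by rewrite -memv0 -i0 gal_ideal_idem // ee.
Qed.

Definition gal_group (g : gT) : A := gunit F g.

Lemma gal_groupM g h : gal_group g * gal_group h = gal_group (g * h).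
Proof.
apply/ffunP => k; rewrite [LHS]tga_gunit ffunE; by case: eqP.
Qed.

Lemma gal_group1 : gal_group 1%g = 1. Proof. by []. Qed.

Lemma gal_groupX g n : gal_group g ^+ n = gal_group (g ^+ n).
Proof.
by elim: n => [|n IHn]; rewrite ?expr0 ?expg0 // exprS expgS IHn gal_groupM.
Qed.

Lemma gal_group_sum a : a = \sum_g a g *: gal_group g.
Proof.
apply/ffunP => k; rewrite sum_ffunE (bigD1 k) //= big1 => [|g gk].
  by rewrite addr0 !ffunE eqxx; exact/esym/mulr1.
by rewrite !ffunE eq_sym (negPf gk); exact: mulr0.
Qed.

End Ideals.

Section Evaluation.
Variables (F : fieldType) (gT : finGroupType) (cG : abelian [set: gT]).
Variable L : fieldExtType F.
Local Notation A := (galg F cG).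

Definition is_char (chi : gT -> L) :=
  chi 1%g = 1 /\ forall g h, chi (g * h)%g = chi g * chi h.

Definition gal_eval (chi : gT -> L) (a : A) : L := \sum_g a g *: chi g.

Lemma gal_eval_linear chi : linear (gal_eval chi).
Proof.
move=> c x y; rewrite /gal_eval scaler_sumr -big_split /=; apply: eq_bigr => g _.
by rewrite !ffunE scalerDl scalerA.
Qed.
HB.instance Definition _ chi :=
  GRing.isLinear.Build F A L _ (gal_eval chi) (gal_eval_linear chi).

Lemma gal_eval_group chi g : gal_eval chi (gal_group F cG g) = chi g.
Proof.
rewrite /gal_eval (bigD1 g) //= big1 => [|h hg]; rewrite ffunE.
  by rewrite eqxx addr0 scale1r.
by rewrite (negPf hg) scale0r.
Qed.

Variables (chi : gT -> L) (chiP : is_char chi).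

Lemma gal_eval1 : gal_eval chi 1 = 1.
Proof. by rewrite -gal_group1 gal_eval_group; case: chiP. Qed.

Lemma gal_evalM a b : gal_eval chi (a * b) = gal_eval chi a * gal_eval chi b.
Proof.
rewrite [a]gal_group_sum mulr_suml !linear_sum mulr_suml; apply: eq_bigr => g _.
rewrite -scalerAl !linearZ /= -scalerAl; congr (_ *: _).
rewrite [b]gal_group_sum mulr_sumr !linear_sum mulr_sumr; apply: eq_bigr => h _.
rewrite -scalerAr !linearZ /= -scalerAr; congr (_ *: _).
by rewrite gal_groupM !gal_eval_group; case: chiP.
Qed.

Lemma gal_evalX a n : gal_eval chi (a ^+ n) = gal_eval chi a ^+ n.
Proof.
by elim: n => [|n IHn]; rewrite ?expr0 ?gal_eval1 // !exprS gal_evalM IHn.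
Qed.

Lemma char_exp g n : chi (g ^+ n)%g = chi g ^+ n.
Proof.
by rewrite -(gal_eval_group _ (g ^+ n)%g) -gal_groupX gal_evalX gal_eval_group.
Qed.

Lemma char_unity g N : (#|gT| %| N)%N -> chi g ^+ N = 1.
Proof.
move=> /dvdnP[k ->]; rewrite mulnC exprM -char_exp -cardsT expg_cardG ?inE //.
by case: chiP => -> _; rewrite expr1n.
Qed.

End Evaluation.

(** Evaluation at the [L]-valued characters embeds the group algebra in a product of copies of [L];
    semisimplicity enters in this form. *)
Definition separates (F : fieldType) (gT : finGroupType)
    (cG : abelian [set: gT]) (L : fieldExtType F) :=
  forall a : galg F cG, a != 0 ->
    exists2 chi : gT -> L, is_char chi & gal_eval chi a != 0.

(** * Von Neumann regularity of the group algebra *)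

Section Separated.
Variables (F : fieldType) (gT : finGroupType) (cG : abelian [set: gT]).
Variables (L : fieldExtType F) (sepA : separates cG L).
Local Notation A := (galg F cG).
Implicit Types (a b e u x y : A).

Lemma separates_eq a b :
  (forall chi : gT -> L, is_char chi -> gal_eval chi a = gal_eval chi b) -> a = b.
Proof.
move=> ab; apply/eqP; rewrite -subr_eq0; apply/negP => /negP /sepA[chi chiP].
by rewrite linearB /= ab // subrr eqxx.
Qed.

(* As A is reduced, multiplication by a and by a^2 have the same kernel, hence
   ideals of the same dimension. *)
Lemma gal_regular a : exists w, a = a * a * w.
Proof.
suff: a \in gal_ideal (a * a) by move/gal_idealP.
have -> : gal_ideal (a * a) = gal_ideal a.
  apply/eqP; rewrite eqEdim; apply/andP; split.
    by apply/subvP => x /gal_idealP[y ->]; apply/gal_idealP; exists (a * y); rewrite mulrA.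
  have := limg_ker_dim (linfun (gal_mull a)) fullv.
  have := limg_ker_dim (linfun (gal_mull (a * a))) fullv.
  rewrite !capfv -/(gal_ideal _) -/(gal_ideal _).
  suff -> : lker (linfun (gal_mull (a * a))) = lker (linfun (gal_mull a)).
    by move=> <- /addnI->.
  apply/vspaceP => y; rewrite !memv_ker !lfunE /= /gal_mull.
  apply/eqP/eqP => [aay|ay]; last by rewrite -mulrA ay mulr0.
  apply: separates_eq => chi chiP; rewrite linear0; apply/eqP.
  have /eqP : gal_eval chi (a * a * y) = 0 by rewrite aay linear0.
  by rewrite !gal_evalM // !mulf_eq0 orbb.
by apply/gal_idealP; exists 1; rewrite mulr1.
Qed.

End Separated.

(** * Dimensions of ideals under ring isomorphisms *)

(** Phrased in ring terms only, so that ring isomorphisms which are not [F]-linear preserve it. *)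
Definition primitive_idem (R : nzRingType) (e : R) :=
  [/\ e != 0, e * e = e &
      forall u : R, u * u = u -> u * e = u -> u = 0 \/ u = e].

Lemma primitive_idem_iso (R S : nzRingType) (f : {rmorphism R -> S})
    (g : {rmorphism S -> R}) e :
  cancel f g -> cancel g f -> primitive_idem e -> primitive_idem (f e).
Proof.
move=> fK gK [e0 ee ePrim]; split.
- by apply: contra_neq e0 => fe0; rewrite -[e]fK fe0 rmorph0.
- by rewrite -rmorphM ee.
- move=> u uu ufe; have [||gu0|guE] := ePrim (g u).
  + by rewrite -rmorphM uu.
  + by apply: (can_inj fK); rewrite rmorphM gK.
  + by left; rewrite -[u]gK gu0 rmorph0.
  + by right; rewrite -guE gK.
Qed.

Section PrimitiveImage.
Variables (F : fieldType) (gT : finGroupType) (cG : abelian [set: gT]).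
Variables (L : fieldExtType F) (sepA : separates cG L).
Local Notation A := (galg F cG).
Variables (e : A) (ePrim : primitive_idem e).
Variables (chi : gT -> L) (chiP : is_char chi) (chie : gal_eval chi e != 0).

Lemma gal_eval_idem : gal_eval chi e = 1.
Proof.
case: ePrim => _ ee _; apply: (mulfI chie).
by rewrite -gal_evalM // ee mulr1.
Qed.

(** Write [a = a * a * w]. Then [a * w] is an idempotent below [e], hence 0 or [e]; a character
    killing [a] kills [a * w] but not [e]. So evaluation embeds the component [e A] in [L]. *)
Lemma gal_eval_primitive_inj (a : A) : e * a = a -> gal_eval chi a = 0 -> a = 0.
Proof.
case: ePrim => _ ee ePr ea chia; have [w Dw] := gal_regular sepA a.
have uu : (a * w) * (a * w) = a * w by rewrite mulrACA mulrA -Dw.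
have ue : (a * w) * e = a * w by rewrite mulrC mulrA ea.
case: (ePr _ uu ue) => [u0|uE]; first by rewrite Dw -mulrA u0 mulr0.
by move: chie; rewrite -uE gal_evalM // chia mul0r eqxx.
Qed.

Definition eval_img : {vspace L} := limg (linfun (gal_eval (cG := cG) chi)).

Lemma dim_primitive_ideal : \dim (gal_ideal e) = \dim eval_img.
Proof.
case: (ePrim) => _ ee _.
have -> : eval_img = (linfun (gal_eval (cG := cG) chi) @: gal_ideal e)%VS.
  apply/eqP; rewrite eqEsubv; apply/andP; split; last exact/limgS/subvf.
  apply/subvP => _ /memv_imgP[a _ ->]; apply/memv_imgP; exists (e * a).
    by rewrite gal_ideal_idem // mulrA ee.
  by rewrite !lfunE /= gal_evalM // gal_eval_idem mul1r.
rewrite limg_dim_eq //; apply/eqP; rewrite -subv0; apply/subvP => a.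
rewrite memv_cap gal_ideal_idem // memv_ker lfunE memv0 => /andP[/eqP ea /eqP chia].
by apply/eqP; apply: gal_eval_primitive_inj.
Qed.

Lemma eval_img_group (V : {vspace L}) :
  (forall g, chi g \in V) -> (eval_img <= V)%VS.
Proof.
move=> chiV; apply/subvP => _ /memv_imgP[a _ ->]; rewrite lfunE /=.
by rewrite memv_suml // => g _; rewrite memvZ.
Qed.

(** Evaluation is injective on the component, so orders of roots of unity can be read off in the
    ring [e A], whose unit is [e]. The exponent is positive because [x ^+ 0] is the unit of [A]
    rather than [e]. *)
Lemma primitive_unity (x : A) j : (0 < j)%N -> e * x = x ->
  (gal_eval chi x ^+ j == 1) = (x ^+ j == e).
Proof.
case: (ePrim) => _ ee _ j0 ex; have exj : e * x ^+ j = x ^+ j.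
  by rewrite -(prednK j0) exprS mulrA ex.
apply/eqP/eqP => [xj|xj]; last by rewrite -gal_evalX // xj gal_eval_idem.
apply/eqP; rewrite -subr_eq0; apply/eqP; apply: gal_eval_primitive_inj.
  by rewrite mulrBr ee exj.
by rewrite linearB /= gal_evalX // xj gal_eval_idem subrr.
Qed.

End PrimitiveImage.

Lemma primitive_root_iff (R1 R2 : nzRingType) (w : R1) (w' : R2) m :
  (forall j, (0 < j)%N -> (w ^+ j == 1) = (w' ^+ j == 1)) ->
  m.-primitive_root w -> m.-primitive_root w'.
Proof.
move=> ww' /andP[m0 /forallP wP]; rewrite /primitive_root_of_unity m0.
by apply/forallP => i; move: (wP i); rewrite !unity_rootE ww'.
Qed.

Section IsoImage.
Variables (F : fieldType) (gT hT : finGroupType).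
Variables (cG : abelian [set: gT]) (cH : abelian [set: hT]).
Variables (L : fieldExtType F) (sepA : separates cG L) (sepB : separates cH L).
Local Notation A := (galg F cG).
Local Notation B := (galg F cH).

(** The image is spanned over [F] by the values [chi h]. If [chi h] has order [m], then [f] sends
    [e * h] to an element whose value under [chi'] also has order [m], and [chi h] is a power of
    that value. The comparison takes place inside [L] and uses only the ring structure. *)
Lemma eval_img_iso (f : {rmorphism A -> B}) (g : {rmorphism B -> A})
    (e : A) (chi : gT -> L) (chi' : hT -> L) :
  cancel f g -> cancel g f -> primitive_idem e -> is_char chi -> is_char chi' ->
  gal_eval chi e != 0 -> gal_eval chi' (f e) != 0 ->
  (eval_img cG chi <= eval_img cH chi')%VS.
Proof.
move=> fK gK ePr chiP chi'P chie chi'e; apply: eval_img_group => h.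
have fePr := primitive_idem_iso fK gK ePr; case: (ePr) => _ ee _.
pose x : A := e * gal_group F cG h; have ex : e * x = x by rewrite mulrA ee.
have fex : f e * f x = f x by rewrite -rmorphM ex.
have chix : gal_eval chi x = chi h.
  by rewrite gal_evalM // (gal_eval_idem ePr) // mul1r gal_eval_group.
have wN : chi h ^+ #|gT| = 1 by apply: char_unity.
have cardG : (0 < #|gT|)%N by rewrite -cardsT cardG_gt0.
have [m mP _] := prim_order_exists cardG wN.
have m'P : m.-primitive_root (gal_eval chi' (f x)).
  apply: primitive_root_iff mP => j j0.
  rewrite -chix (primitive_unity sepA ePr) // (primitive_unity sepB fePr) //.
  by rewrite -rmorphXn (can_eq fK).
have [i ->] := prim_rootP m'P (prim_expr_order mP).
by rewrite -gal_evalX // -[gal_eval _ _]lfunE memv_img ?memvf.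
Qed.

End IsoImage.

Section IsoDim.
Variables (F : fieldType) (gT hT : finGroupType).
Variables (cG : abelian [set: gT]) (cH : abelian [set: hT]).
Variables (L : fieldExtType F) (sepA : separates cG L) (sepB : separates cH L).
Local Notation A := (galg F cG).
Local Notation B := (galg F cH).

(** Splitting idempotents reduces the claim, by induction on the dimension, to primitive [e], where
    both dimensions are that of the same subspace of [L]. *)
Lemma gal_ideal_dim_iso (f : {rmorphism A -> B}) (g : {rmorphism B -> A}) (e : A) :
  cancel f g -> cancel g f -> e * e = e ->
  \dim (gal_ideal (f e)) = \dim (gal_ideal e).
Proof.
move=> fK gK; have [n] := ubnP (\dim (gal_ideal e)).
elim: n e => // n IHn e; rewrite ltnS => dim_e ee.
have fee : f e * f e = f e by rewrite -rmorphM ee.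
have [->|e0] := eqVneq e 0.
  rewrite rmorph0; suff [-> ->] : gal_ideal (0 : A) = 0%VS /\ gal_ideal (0 : B) = 0%VS.
    by rewrite !dimv0.
  by split; apply/eqP; rewrite -subv0; apply/subvP => x /gal_idealP[y ->];
     rewrite mul0r mem0v.
case: (classic (primitive_idem e)) => [ePr|nePr].
  have fePr := primitive_idem_iso fK gK ePr.
  have [fe0 _ _] := fePr.
  have [chi chiP chie] := sepA e0; have [chi' chi'P chi'e] := sepB fe0.
  rewrite (dim_primitive_ideal sepA ePr chiP chie).
  rewrite (dim_primitive_ideal sepB fePr chi'P chi'e).
  congr (\dim _); apply/eqP; rewrite eqEsubv.
  rewrite (eval_img_iso sepA sepB fK gK ePr) //.
  by rewrite (eval_img_iso sepB sepA gK fK fePr) // fK.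
have [u [uu ue u0 u_e]] : exists u : A, [/\ u * u = u, u * e = u, u != 0 & u != e].
  apply: NNPP => nu; apply: nePr; split=> // u uu ue.
  have [->|u0] := eqVneq u 0; first by left.
  have [->|ue'] := eqVneq u e; first by right.
  by case: nu; exists u.
have vv : (e - u) * (e - u) = e - u.
  by rewrite mulrBl !mulrBr ee [e * u]mulrC ue uu subrr subr0.
have v0 : e - u != 0 by rewrite subr_eq0 eq_sym.
have dimD := gal_ideal_dimD ee uu ue.
rewrite dimD (gal_ideal_dimD fee (u := f u)); try by rewrite -rmorphM ?uu ?ue.
rewrite -rmorphB !IHn //; apply: leq_trans dim_e; rewrite dimD.
  by rewrite -[ltnLHS]add0n ltn_add2r gal_ideal_gt0.
by rewrite -[ltnLHS]addn0 ltn_add2l gal_ideal_gt0.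
Qed.

End IsoDim.

(** * Counting elements of bounded exponent *)

Section PowerMorphism.
Local Open Scope group_scope.
Variables (gT : finGroupType) (cG : abelian [set: gT]) (n : nat).

Definition expg_hom (g : gT) : gT := (g ^+ n)%g.

Lemma expg_homM : {in [set: gT] &, {morph expg_hom : x y / (x * y)%g}}.
Proof. by move=> x y _ _; apply: expgMn; exact: mulgC_setT. Qed.

Canonical expg_morphism := Morphism expg_homM.

Lemma card_expg_index :
  (#|[set: gT] : expg_morphism @* [set: gT]|%g) = #|[set g : gT | (g ^+ n)%g == 1%g]|.
Proof.
have -> : [set g : gT | (g ^+ n)%g == 1%g] = 'ker expg_morphism.
  by apply/setP => g; rewrite !inE.
apply/eqP; rewrite -(eqn_pmul2l (cardG_gt0 (expg_morphism @* [set: gT]))).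
rewrite Lagrange ?subsetT // card_morphim setIT.
by rewrite mulnC Lagrange ?subsetT.
Qed.

End PowerMorphism.

(** * The ideal of functions invariant under D-th powers *)

Section PowerIdempotent.
Variables (F : fieldType) (gT : finGroupType) (cG : abelian [set: gT]).
Variables (cardF : #|gT|%:R != 0 :> F) (D : nat).
Local Notation A := (galg F cG).
Implicit Types (e x y : A).
Local Notation K := (expg_morphism cG D @* [set: gT])%G.

(** The D-th power map hits each element of its image [K] equally often, so this is the averaging
    idempotent of [K]. A character takes it to 1 if it is trivial on [K] and to 0 otherwise. *)
Definition gal_pow_idem : A := #|gT|%:R^-1 *: \sum_(g : gT) gal_group F cG (g ^+ D)%g.
Local Notation eps := gal_pow_idem.

Lemma gal_groupE g x k : (gal_group F cG g * x) k = x (g^-1 * k)%g.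
Proof.
rewrite [LHS]galg_mulE (bigD1 g) //= big1 ?addr0 => [|h hg].
  by rewrite ffunE eqxx mul1r.
by rewrite ffunE (negPf hg) mul0r.
Qed.

Lemma gal_pow_idem_group g : gal_group F cG (g ^+ D)%g * eps = eps.
Proof.
rewrite -scalerAr mulr_sumr; congr (_ *: _).
rewrite [RHS](reindex_inj (mulgI g)); apply: eq_bigr => h _.
by rewrite gal_groupM expgMn //; exact: mulgC_setT.
Qed.

Lemma gal_pow_idem_id e : (forall g, gal_group F cG (g ^+ D)%g * e = e) -> eps * e = e.
Proof.
move=> eP; rewrite -scalerAl mulr_suml (eq_bigr (fun _ => e)) => [|g _]; last exact: eP.
by rewrite sumr_const -scaler_nat scalerA mulVf ?scale1r.
Qed.

Lemma gal_pow_idem_idem : eps * eps = eps.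
Proof. exact/gal_pow_idem_id/gal_pow_idem_group. Qed.

Let pull (y : {ffun coset_of K -> F^o}) : A := [ffun g => y (coset K g)].
Let pull_linear : linear pull.
Proof. by move=> c u v; apply/ffunP => g; rewrite !ffunE. Qed.
HB.instance Definition _ := GRing.isLinear.Build F _ A _ pull pull_linear.

(** The ideal consists of the functions constant on cosets of [K], that is, of the image of [pull].
    Its dimension is the index of [K], which is the order of the kernel of the D-th power map. *)
Lemma gal_pow_idem_dim :
  \dim (gal_ideal eps) = #|[set g : gT | (g ^+ D)%g == 1%g]|.
Proof.
have nK g : g \in 'N(K)%g by apply: (subsetP (sub_abelian_norm cG (subsetT _))); rewrite inE.
rewrite -(card_expg_index cG) -card_quotient; last by apply/subsetP => g _; apply: nK.
have -> : gal_ideal eps = limg (linfun pull).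
  apply/eqP; rewrite eqEsubv; apply/andP; split; apply/subvP => x; last first.
    case/memv_imgP => y _ ->; rewrite lfunE /= gal_ideal_idem; last exact: gal_pow_idem_idem.
    apply/eqP/gal_pow_idem_id => g; apply/ffunP => k; rewrite gal_groupE !ffunE.
    have gK : (g ^+ D)%g \in K.
      exact: (mem_morphim (expg_morphism cG D) (in_setT g) (in_setT g)).
    congr (y _); rewrite morphM ?groupV ?nK // morphV ?nK //=.
    by rewrite (coset_id gK) invg1 mul1g.
  rewrite gal_ideal_idem; last exact: gal_pow_idem_idem.
  move=> /eqP epsx; apply/memv_imgP;
    exists [ffun c : coset_of K => x (repr c) : F^o]; rewrite ?memvf //.
  apply/ffunP => g; rewrite lfunE /= !ffunE.
  have /morphimP[h _ _ Dh] : (g * (repr (coset K g))^-1)%g \in K.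
    apply: coset_idr; rewrite ?nK // morphM ?nK ?groupV ?nK //.
    by rewrite morphV ?nK //= coset_reprK mulgV.
  have /(congr1 (fun y : A => y g)) : gal_group F cG (h ^+ D)%g * x = x.
    by rewrite -epsx mulrA gal_pow_idem_group.
  rewrite gal_groupE => <-; congr (x _).
  by rewrite -[(h ^+ D)%g]/(expg_hom D h) -Dh invMg invgK mulgKV.
rewrite limg_dim_eq ?dimvf /dim /= ?muln1.
  by apply: eq_card => c; rewrite -[in RHS](coset_reprK c) mem_quotient ?inE.
apply/eqP; rewrite -subv0; apply/subvP => y.
rewrite memv_cap memvf memv_ker lfunE memv0 => /eqP y0; apply/eqP/ffunP => c.
by have /ffunP/(_ (repr c)) := y0; rewrite !ffunE coset_reprK.
Qed.

Variables (L : fieldExtType F) (sepA : separates cG L).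
Variables (N : nat) (GN : (#|gT| %| N)%N) (z : L) (zN : N.-primitive_root z).
Variables (E : {subfield L}) (D0 : (0 < D)%N).
Variables (zE : forall i, (z ^+ i \in E) = (z ^+ i ^+ D == 1)).

(* This characterises the idempotents below eps in terms of the ring A alone. *)
Lemma gal_pow_idem_max e : e * e = e ->
  e * eps = e <-> (forall x, e * x = x -> x ^+ N = e -> x ^+ D = e).
Proof.
move=> ee; have eX n : (0 < n)%N -> e ^+ n = e.
  by case: n => // n _; elim: n => // n IHn; rewrite exprS IHn.
have N0 := prim_order_gt0 zN; split=> [eeps x ex xN | eP]; last first.
  rewrite mulrC; apply: gal_pow_idem_id => g.
  rewrite mulrC -gal_groupX -[in LHS](eX D) // -exprMn; apply: eP.
    by rewrite mulrA ee.
  rewrite exprMn eX // gal_groupX; case/dvdnP: GN => m ->; rewrite mulnC expgM.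
  by rewrite -cardsT expg_cardG ?inE // expg1n gal_group1 mulr1.
apply: (separates_eq sepA) => chi chiP; rewrite gal_evalX //.
have : gal_eval chi e * (gal_eval chi e - 1) = 0.
  by rewrite mulrBr mulr1 -gal_evalM // ee subrr.
move/eqP; rewrite mulf_eq0 subr_eq0 => /orP[/eqP e0|/eqP e1].
  by rewrite -ex gal_evalM // e0 mul0r expr0n eqn0Ngt D0.
have eps1 : gal_eval chi eps = 1.
  by rewrite -[LHS]mul1r -[X in X * _]e1 -gal_evalM // eeps.
(* [eps] has value 1 and absorbs D-th powers, so [chi] is trivial on these, and [zE] puts the root
   of unity [chi g] into [E]. *)
have chiE g : chi g \in E.
  have [i Di] := prim_rootP zN (char_unity cG chiP g GN).
  rewrite Di zE -Di -(char_exp cG chiP); apply/eqP; rewrite -[LHS]mulr1 -eps1.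
  by rewrite -(gal_eval_group cG) -gal_evalM // gal_pow_idem_group.
have xE : gal_eval chi x \in E.
  apply: (subvP (eval_img_group cG chiE)).
  by rewrite -[gal_eval _ _]lfunE memv_img ?memvf.
have xN1 : gal_eval chi x ^+ N = 1 by rewrite -gal_evalX // xN.
have [i Di] := prim_rootP zN xN1; rewrite e1; apply/eqP.
by rewrite Di -zE -Di.
Qed.

End PowerIdempotent.

Section PowerCount.
Variables (F : fieldType) (gT hT : finGroupType).
Variables (cG : abelian [set: gT]) (cH : abelian [set: hT]).
Variables (L : fieldExtType F) (sepA : separates cG L) (sepB : separates cH L).
Variables (cardG : #|gT|%:R != 0 :> F) (cardH : #|hT|%:R != 0 :> F).
Variables (N : nat) (GN : (#|gT| %| N)%N) (HN : (#|hT| %| N)%N).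
Variables (z : L) (zN : N.-primitive_root z) (E : {subfield L}) (D : nat).
Variables (D0 : (0 < D)%N) (zE : forall i, (z ^+ i \in E) = (z ^+ i ^+ D == 1)).
Variables (f : {rmorphism galg F cG -> galg F cH}) (g : {rmorphism galg F cH -> galg F cG}).

Lemma gal_pow_idem_iso : cancel f g -> cancel g f ->
  f (gal_pow_idem F cG D) * gal_pow_idem F cH D = f (gal_pow_idem F cG D).
Proof.
move=> fK gK; have epsG := gal_pow_idem_idem cG cardG D.
apply/(gal_pow_idem_max cardH sepB HN zN D0 zE); first by rewrite -rmorphM epsG.
move=> x ex xN; apply: (can_inj gK); rewrite rmorphXn fK.
have [/(_ epsG) maxG _] := gal_pow_idem_max cardG sepA GN zN D0 zE epsG.
by apply: maxG; [rewrite -[X in X * _]fK -rmorphM ex | rewrite -rmorphXn xN fK].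
Qed.

End PowerCount.

(** The characterisation by maximality, used for [f] and for [g], shows that [f] matches the two
    averaging idempotents; the dimensions of their ideals are the two counts. *)
Lemma card_pow1_iso (F : fieldType) (gT hT : finGroupType)
    (cG : abelian [set: gT]) (cH : abelian [set: hT]) (L : fieldExtType F)
    (sepA : separates cG L) (sepB : separates cH L)
    (cardG : #|gT|%:R != 0 :> F) (cardH : #|hT|%:R != 0 :> F)
    (N : nat) (GN : (#|gT| %| N)%N) (HN : (#|hT| %| N)%N)
    (z : L) (zN : N.-primitive_root z) (E : {subfield L}) (D : nat)
    (D0 : (0 < D)%N) (zE : forall i, (z ^+ i \in E) = (z ^+ i ^+ D == 1))
    (f : {rmorphism galg F cG -> galg F cH}) (g : {rmorphism galg F cH -> galg F cG}) :
  cancel f g -> cancel g f ->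
  #|[set x : gT | (x ^+ D)%g == 1%g]| = #|[set x : hT | (x ^+ D)%g == 1%g]|.
Proof.
move=> fK gK; rewrite -(gal_pow_idem_dim cG cardG) -(gal_pow_idem_dim cH cardH).
rewrite -(gal_ideal_dim_iso sepA sepB fK gK); last exact: gal_pow_idem_idem.
congr (\dim (gal_ideal _)).
rewrite -(gal_pow_idem_iso sepA sepB cardG cardH GN HN zN D0 zE fK gK).
have := gal_pow_idem_iso sepB sepA cardH cardG HN GN zN D0 zE gK fK.
by move/(congr1 f); rewrite rmorphM !gK mulrC.
Qed.

(** * Coordinates and separation by characters *)

Section Coordinates.
Local Open Scope group_scope.
Local Open Scope nat_scope.
Variable gT : finGroupType.
Implicit Types (b : seq gT) (X : nat -> gT -> nat) (G : {set gT}).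

(** [X i g] is the exponent of the i-th basis element in [g], a natural number that matters only
    modulo the order of that element. Beyond the end of [b] the default 1 has order 1, and the
    additivity condition is vacuous. *)
Definition coordinates G b X :=
  [/\ {subset b <= G},
      forall i, {in G &, forall g h, X i (g * h)%g = X i g + X i h %[mod #[nth 1%g b i]]},
      forall i j, i < size b -> j < size b ->
        X i (nth 1%g b j) = (i == j) %[mod #[nth 1%g b i]] &
      {in G, forall g, g = (\prod_(i < size b) nth 1 b i ^+ X i g)%g}].

Lemma cycle_log (x : gT) :
  exists l : gT -> nat, {in <[x]>%g, forall y, y = (x ^+ l y)%g}.
Proof.
exists (fun y => find (fun k => (x ^+ k)%g == y) (iota 0 #[x])) => y /cyclePmin[i ix ->].
have hasi : has (fun k => (x ^+ k)%g == (x ^+ i)%g) (iota 0 #[x]).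
  by apply/hasP; exists i; rewrite ?mem_iota.
have := nth_find 0 hasi; rewrite nth_iota ?add0n; first by move/eqP.
by rewrite -[X in _ < X](size_iota 0) -has_find.
Qed.

(** Induction on the basis: [divgr] and [remgr] project onto the first cyclic factor and onto its
    complement. *)
Lemma coordinates_exist b (G : {group gT}) :
  \big[dprod/1%g]_(x <- b) <[x]>%g = G -> exists X, coordinates G b X.
Proof.
elim: b G => [|x b IHb] G.
  rewrite big_nil => G1; exists (fun _ _ => 0); split=> // g.
  by rewrite -G1 inE => /eqP->; rewrite big_ord0.
rewrite big_cons => defG; have /dprodP[[_ H _ defH] mulxH cxH tixH] := defG.
rewrite defH in defG mulxH cxH tixH; have [X [bH XM Xb Xg]] := IHb H defH.
have [l lP] := cycle_log x.
have HcK : H \in [complements to <[x]> in G]%g by apply/complP; split.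
have nKG : (<[x]> <| G)%g by have /dprod_normal2[] := defG.
have memG g : g \in G -> g \in (<[x]> * H)%g by rewrite mulxH.
exists (fun i g => if i is i'.+1 then X i' (remgr <[x]> H g) else l (divgr <[x]> H g)).
split.
- move=> y; rewrite inE -mulxH => /predU1P[->|/bH Hy].
    by rewrite -[X in X \in _]mulg1 mem_mulg ?group1 ?cycle_id.
  by rewrite -[y]mul1g mem_mulg ?group1.
- case=> [|i] g h Gg Gh /=; last first.
    by rewrite (remgrM HcK) // XM // mem_remgr ?memG.
  apply/eqP; rewrite -eq_expg_mod_order expgD -!lP ?mem_divgr ?memG ?groupM //.
  by rewrite (divgrM HcK).
- case=> [|i] [|j] /= ib jb.
  + apply/eqP; rewrite -eq_expg_mod_order expg1 -lP ?divgr_id ?cycle_id //.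
  + apply/eqP; rewrite -eq_expg_mod_order -lP.
      by rewrite -[nth _ _ _]mul1g divgrMid ?bH ?mem_nth ?group1.
    by rewrite -[nth _ _ _]mul1g divgrMid ?bH ?mem_nth ?group1.
  + rewrite remgr1 ?cycle_id //; have := XM i 1%g 1%g (group1 H) (group1 H).
    rewrite mulg1 => /eqP; rewrite -{1}[X i 1%g]addn0 eqn_modDl eq_sym => /eqP->.
    by [].
  + by rewrite -[nth _ _ j]mul1g remgrMid ?bH ?mem_nth ?group1 ?mul1g ?Xb.
- move=> g Gg; rewrite big_ord_recl /= -lP ?mem_divgr ?memG //.
  by rewrite -Xg ?mem_remgr ?memG // -divgr_eq.
Qed.
End Coordinates.

(** Fourier inversion: an element killed by all characters has vanishing coefficients. *)
Lemma prim_root_separates (F : fieldType) (gT : finGroupType) (cG : abelian [set: gT])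
    (L : fieldExtType F) N (z : L) :
  N.-primitive_root z -> (#|gT| %| N)%N -> separates cG L.
Proof.
move=> zN GN a /eqP a0; apply: NNPP => nchi; apply: a0.
have [b defG _] := abelian_structure cG; pose r := size b.
have [X [_ XM _ Xg]] := coordinates_exist defG.
pose w i := z ^+ (N %/ #[nth 1 b i]%g).
have wP i : (#[nth 1 b i]%g).-primitive_root (w i).
  apply: dvdn_prim_root => //; apply: dvdn_trans GN.
  by rewrite -cardsT order_dvdG ?inE.
(* All exponents [y i] range over ['I_N], so characters are repeated; this only scales the
   orthogonality relations by an invertible number, as [N] is nonzero in [L]. *)
pose chi (y : {ffun 'I_r -> 'I_N}) g : L := \prod_(i < r) (w i ^+ X i g) ^+ y i.
have wM i g h : w i ^+ X i (g * h)%g = w i ^+ X i g * w i ^+ X i h.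
  by rewrite -exprD; apply/eqP; rewrite (eq_prim_root_expr (wP i)) XM ?inE.
have w1 i : w i ^+ X i 1%g = 1.
  have := wM i 1%g 1%g; rewrite mulg1 -[LHS]mulr1 => /mulfI->//.
  by rewrite expf_neq0 // (prim_root_eq0 (wP i)) -lt0n order_gt0.
have chiP y : is_char (chi y).
  split=> [|g h]; first by rewrite /chi big1 // => i _; rewrite w1 expr1n.
  by rewrite /chi -big_split /=; apply: eq_bigr => i _; rewrite wM exprMn.
(* The sum over [y] factors into one geometric sum per coordinate, and a coordinate where [u] is
   nontrivial contributes 0. *)
have sum_chi u : u != 1%g -> \sum_y chi y u = 0.
  move=> u1; rewrite -(bigA_distr_bigA (fun (i : 'I_r) (j : 'I_N) => (w i ^+ X i u) ^+ j)) /=.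
  have [i wi] : exists i : 'I_r, w i ^+ X i u != 1.
    apply/existsP; apply: contraNT u1; rewrite negb_exists => /forallP wu.
    rewrite (Xg u) ?inE // big1 // => i _; apply/eqP.
    by rewrite -order_dvdn (prim_order_dvd (wP i)) -[_ == 1]negbK wu.
  rewrite (bigD1 i) //=; apply/eqP; rewrite mulf_eq0; apply/orP; left.
  have /eqP : (w i ^+ X i u) ^+ N - 1 = 0.
    have [k Dk] : exists k, N = (#[nth 1 b i]%g * k)%N.
      have /dvdnP[k ->] : (#[nth 1 b i]%g %| N)%N.
        by apply: dvdn_trans GN; rewrite -cardsT order_dvdG ?inE.
      by exists k; rewrite mulnC.
    by rewrite exprAC Dk exprM (prim_expr_order (wP i)) !expr1n subrr.
  by rewrite subrX1 mulf_eq0 subr_eq0 (negPf wi).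
have chia y : gal_eval (chi y) a = 0.
  by apply/eqP/negP => /negP chia; case: nchi; exists (chi y).
apply/ffunP => h; rewrite ffunE.
(* By orthogonality this sum is also [N ^ r] times the coefficient of [a] at [h]. *)
have : \sum_y chi y h^-1%g * gal_eval (chi y) a = 0.
  by rewrite big1 // => y _; rewrite chia mulr0.
under eq_bigr do rewrite mulr_sumr.
rewrite exchange_big (bigD1 h) //= [X in _ + X]big1 ?addr0 => [|g gh]; last first.
  under eq_bigr => y _ do rewrite -scalerAr -(chiP y).2.
  by rewrite -scaler_sumr sum_chi ?scaler0 // -eq_mulVg1 eq_sym.
under eq_bigr => y _ do rewrite -scalerAr -(chiP y).2 mulVg (chiP y).1.
rewrite -scaler_sumr sumr_const card_ffun !card_ord natrX => /eqP.
rewrite scaler_eq0 expf_eq0 (negPf (prim_root_natf_neq0 zN)) andbF orbF.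
by move/eqP.
Qed.

(** * Primitive roots of unity in extensions *)

Lemma irreducible_factor (F : fieldType) (p : {poly F}) :
  (1 < size p)%N -> exists2 q, irreducible_poly q & q %| p.
Proof.
have [n] := ubnP (size p); elim: n p => // n IHn p; rewrite ltnS => pn p1.
have p0 : p != 0 by rewrite -size_poly_gt0 ltnW.
case: (classic (irreducible_poly p)) => [irr_p|red_p]; first by exists p.
have [d d1 [dp dNp]] : exists2 d : {poly F}, size d != 1%N & d %| p /\ ~~ (d %= p).
  apply: NNPP => nd; apply: red_p; split=> // d d1 dp; apply/negP => /negP dNp.
  by case: nd; exists d.
have d0 : d != 0 by apply: contraTneq dp => ->; rewrite dvd0p.
have dsz : (size d < size p)%N by rewrite ltn_neqAle dvdp_leq // dvdp_size_eqp ?dNp.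
have [||q irr_q qd] := IHn d; first exact: leq_trans pn.
  by rewrite ltn_neqAle eq_sym d1 size_poly_gt0.
by exists q => //; apply: dvdp_trans dp.
Qed.

(* A root of Phi_N is primitive when N is invertible: otherwise it would also
   be a root of some other Phi_d and hence a double root of X^N - 1. *)
Lemma root_Cyclotomic_prim (L : fieldType) N (z : L) :
  N%:R != 0 :> L -> root (map_poly intr 'Phi_N) z -> N.-primitive_root z.
Proof.
move=> NL; have N0 : (0 < N)%N by rewrite lt0n; apply: contraNneq NL => ->.
pose P d : {poly L} := map_poly intr 'Phi_d; rewrite -/(P N) => Pz.
have prodP n : (0 < n)%N -> \prod_(d <- divisors n) P d = 'X^n - 1.
  move=> n0; rewrite -rmorph_prod prod_Cyclotomic // rmorphB rmorph1 /=.
  by rewrite map_polyXn.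
have NN : N \in divisors N by rewrite divisors_id.
have zN : z ^+ N = 1.
  apply/eqP; rewrite -subr_eq0; have := congr1 (horner^~ z) (prodP N N0).
  rewrite (big_rem N) //= hornerM (eqP Pz) mul0r hornerD hornerN hornerXn hornerC.
  by move/esym/eqP.
have [m zm mN] := prim_order_exists N0 zN.
have [<-//|m'N] := eqVneq m N; have m0 := prim_order_gt0 zm.
have [d dm Pd] : exists2 d, d \in divisors m & root (P d) z.
  have : root (\prod_(d <- divisors m) P d) z.
    rewrite prodP // rootE hornerD hornerN hornerXn hornerC (prim_expr_order zm).
    by rewrite subrr.
  rewrite -[root _ _]negbK -(big_map P xpredT id) root_bigmul -has_predC.
  by case/hasP=> _ /mapP[d dm ->] /=; rewrite negbK; exists d.
have dN : d \in rem N (divisors N).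
  move: dm; rewrite mem_rem_uniq ?divisors_uniq // -!dvdn_divisors // inE => dm.
  rewrite -dvdn_divisors // (dvdn_trans dm mN) andbT.
  by apply: contraNneq m'N => dN; rewrite eqn_dvd mN -dN.
have := congr1 (fun p => p^`().[z]) (prodP N N0).
rewrite (big_rem N) //= (big_rem d dN) /= !derivE !hornerE (eqP Pz) (eqP Pd).
rewrite /= !(mul0r, mulr0, addr0, subr0) hornerMn hornerXn => /esym/eqP.
rewrite -mulr_natr mulf_eq0 (negPf NL) orbF expf_eq0 => /andP[_].
by rewrite (prim_root_eq0 zm) eqn0Ngt m0.
Qed.

(** A root of an irreducible factor over [F] of the N-th cyclotomic polynomial is adjoined. *)
Lemma prim_root_extension (F : fieldType) N :
  N%:R != 0 :> F -> exists (L : fieldExtType F) (z : L), N.-primitive_root z.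
Proof.
move=> NF; pose P : {poly F} := map_poly intr 'Phi_N.
have N0 : (0 < N)%N by rewrite lt0n; apply: contraNneq NF => ->.
have [|q irr_q qP] := @irreducible_factor F P.
  rewrite size_map_poly_id0 ?size_Cyclotomic ?ltnS ?totient_gt0 //.
  by rewrite (monicP (Cyclotomic_monic N)) oner_eq0.
have [L _ [z qz _]] := irredp_FAdjoin irr_q; exists L, z.
apply: root_Cyclotomic_prim.
  by rewrite -(rmorph_nat (in_alg L)) fmorph_eq0.
have -> : map_poly intr 'Phi_N = map_poly (in_alg L) P.
  by rewrite -map_poly_comp; apply: eq_map_poly => c; exact/esym/(rmorph_int (in_alg L)).
by case/dvdpP: qP => p ->; rewrite rmorphM rootM qz orbT.
Qed.

(** If the group order vanished in [F], the sum of all group elements would be nonzero of square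
    zero, contradicting regularity. *)
Lemma gal_regular_card (F : fieldType) (gT : finGroupType) (cG : abelian [set: gT]) :
  (forall a : galg F cG, exists w, a = a * a * w) -> #|gT|%:R != 0 :> F.
Proof.
pose s : galg F cG := \sum_g gal_group F cG g; move=> /(_ s)[w Ds].
have gs g : gal_group F cG g * s = s.
  rewrite mulr_sumr [RHS](reindex_inj (mulgI g)); apply: eq_bigr => h _.
  by rewrite gal_groupM.
apply/eqP => cardF0; have ss : s * s = 0.
  rewrite {1}/s mulr_suml (eq_bigr (fun _ => s)) // sumr_const.
  by rewrite -[#|_|]/#|gT| -scaler_nat cardF0 scale0r.
have /ffunP/(_ 1%g)/eqP : s = 0 by rewrite Ds ss mul0r.
rewrite sum_ffunE (bigD1 1%g) //= big1 => [|g g1].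
  by rewrite !ffunE eqxx addr0 oner_eq0.
by rewrite ffunE eq_sym (negPf g1).
Qed.

(** * Commutators of cocycles *)

Section Commutator.
Variables (F : fieldType) (gT : finGroupType) (cG : abelian [set: gT]).
Implicit Types (a b : gT -> gT -> F).

(** The scalar [c] with [u_g u_h = c u_h u_g] in the twisted group algebra. *)
Definition comm_coc a (g h : gT) : F := a g h / a h g.

Definition alternating (B : gT -> gT -> F) :=
  [/\ forall g h k, B (g * h)%g k = B g k * B h k,
      forall g h k, B g (h * k)%g = B g h * B g k &
      forall g, B g g = 1].

Lemma comm_cocV a g h : (comm_coc a g h)^-1 = comm_coc a h g.
Proof. by rewrite /comm_coc invfM invrK mulrC. Qed.

Lemma comm_coc_alternating a : cocycle a -> alternating (comm_coc a).
Proof.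
case=> a0 aA; have Ml g h k : comm_coc a (g * h)%g k = comm_coc a g k * comm_coc a h k.
  have E1 := aA g h k; have E2 := aA k g h; have E3 := aA g k h.
  rewrite (mulgC_setT cG k g) in E2; rewrite (mulgC_setT cG k h) in E3.
  rewrite /comm_coc mulf_div; apply/eqP; rewrite eqr_div ?mulf_neq0 //; apply/eqP.
  apply: (mulfI (a0 g h)); apply: (mulIf (a0 (g * k)%g h)); apply: (mulIf (a0 g h)).
  (* The extra factors allow both sides to be regrouped into products to which the three cocycle
     identities apply. *)
  have -> : a g h * (a (g * h)%g k * (a k g * a k h)) * a (g * k)%g h * a g h =
    (a g h * a (g * h)%g k) * (a k g * a (g * k)%g h) * a k h * a g h by ring.
  have -> : a g h * (a g k * a h k * a k (g * h)%g) * a (g * k)%g h * a g h =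
    (a g k * a (g * k)%g h) * (a g h * a k (g * h)%g) * a h k * a g h by ring.
  by rewrite E1 E2 E3; ring.
split=> // [g h k|g]; last by rewrite /comm_coc divff.
by rewrite -comm_cocV Ml invfM !comm_cocV.
Qed.

(** Coboundaries on an abelian group are symmetric and cancel in the quotient. *)
Lemma comm_coc_cohom a b : (forall g h, a g h != 0) -> cohom a b ->
  forall g h, comm_coc b g h = comm_coc a g h.
Proof.
move=> a0 [beta [beta0 Db]] g h; rewrite /comm_coc !Db (mulgC_setT cG h g).
by field; rewrite ?a0 ?beta0.
Qed.

Lemma comm_cocM a b g h : comm_coc (cmul a b) g h = comm_coc a g h * comm_coc b g h.
Proof. by rewrite /comm_coc /cmul -mulf_div. Qed.

Lemma cocycle_mul a b : cocycle a -> cocycle b -> cocycle (cmul a b).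
Proof.
move=> [a0 aA] [b0 bA]; split=> [g h|g h k]; first by rewrite mulf_neq0.
by rewrite /cmul mulrACA aA bA mulrACA.
Qed.

Lemma cocycle_inv a : cocycle a -> cocycle (fun g h => (a g h)^-1).
Proof. by case=> a0 aA; split=> [g h|g h k]; rewrite ?invr_eq0 // -!invfM aA. Qed.

Lemma cocycle_exp a n : cocycle a -> cocycle (fun g h => a g h ^+ n).
Proof. by case=> a0 aA; split=> [g h|g h k]; rewrite ?expf_neq0 // -!exprMn aA. Qed.

Lemma cohom_refl a b : (forall g h, b g h = a g h) -> cohom a b.
Proof.
move=> ab; exists (fun _ => 1); split=> [g|g h]; first exact: oner_neq0.
by rewrite divr1 !mulr1.
Qed.

Lemma tga_mulC a : (forall g h, comm_coc a g h = 1) -> (forall g h, a g h != 0) ->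
  commutative (tga_mul a).
Proof.
move=> a1 a0 x y; have aC g h : a g h = a h g by apply: divr1_eq; apply: a1.
apply/ffunP => k; rewrite !tga_mulE.
rewrite (reindex_inj (inj_comp (mulgI k) invg_inj)) /=; apply: eq_bigr => g _.
rewrite invMg invgK mulgKV [x _ * _]mulrC aC (mulgC_setT cG k).
by [].
Qed.

Lemma comm_coc_tga a : (forall g h, a g h != 0) ->
  commutative (tga_mul a) -> forall g h, comm_coc a g h = 1.
Proof.
move=> a0 aC g h; have /ffunP/(_ (g * h)%g) := aC (gunit F g) (gunit F h).
by rewrite !tga_gunit eqxx (mulgC_setT cG h g) eqxx !mulr1n /comm_coc => ->; rewrite divff.
Qed.

End Commutator.

Lemma tga_iso_comm (F : fieldType) (gT hT : finGroupType) (a : gT -> gT -> F)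
    (b : hT -> hT -> F) : tga_iso a b ->
  commutative (tga_mul a) <-> commutative (tga_mul b).
Proof.
case=> f [[g fK gK] _ fM]; split=> C x y; last by apply: (can_inj fK); rewrite !fM C.
by rewrite -[x]gK -[y]gK -!fM C.
Qed.

(** * The effect of psi on commutator forms *)

Section PsiComm.
Variables (F : fieldType) (gT hT : finGroupType).
Variables (cG : abelian [set: gT]) (cH : abelian [set: hT]).
Variable psi : (gT -> gT -> F) -> (hT -> hT -> F).
Hypothesis psi_coc : forall a, cocycle a -> cocycle (psi a).
Hypothesis psi_cohom :
  forall a b, cocycle a -> cocycle b -> cohom a b -> cohom (psi a) (psi b).
Hypothesis psiM : forall a b, cocycle a -> cocycle b ->
  cohom (psi (cmul a b)) (cmul (psi a) (psi b)).
Hypothesis psi_iso : forall a, cocycle a -> tga_iso a (psi a).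

(** Both sides say that a twisted group algebra is commutative, which a ring isomorphism
    preserves. *)
Lemma psi_comm1 a : cocycle a ->
  (forall g h, comm_coc a g h = 1) <-> (forall g h, comm_coc (psi a) g h = 1).
Proof.
move=> aP; have [a0 _] := aP; have [b0 _] := psi_coc aP.
have isoC := tga_iso_comm (psi_iso aP).
split=> [a1|b1].
  by apply: (comm_coc_tga cH) => //; apply/isoC/(tga_mulC cG).
by apply: (comm_coc_tga cG) => //; apply/isoC/(tga_mulC cH).
Qed.

Lemma psi_comm_ext a b : cocycle a -> cocycle b -> (forall g h, b g h = a g h) ->
  forall g h, comm_coc (psi b) g h = comm_coc (psi a) g h.
Proof.
move=> aP bP ab; apply: (comm_coc_cohom cH); first exact: (psi_coc aP).1.
exact/psi_cohom/cohom_refl.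
Qed.

Lemma psi_commM a b g h : cocycle a -> cocycle b ->
  comm_coc (psi (cmul a b)) g h = comm_coc (psi a) g h * comm_coc (psi b) g h.
Proof.
move=> aP bP; rewrite -comm_cocM; apply/esym/(comm_coc_cohom cH).
  exact: (psi_coc (cocycle_mul aP bP)).1.
exact: psiM.
Qed.

(** Triviality of the commutator form, applied to the quotient of [a] by [b]: thus [psi] induces a
    well-defined injective map on commutator forms. *)
Lemma psi_comm_eq a b : cocycle a -> cocycle b ->
  (forall g h, comm_coc a g h = comm_coc b g h) <->
  (forall g h, comm_coc (psi a) g h = comm_coc (psi b) g h).
Proof.
move=> aP bP; pose q := cmul a (fun g h => (b g h)^-1).
have qP : cocycle q by apply/cocycle_mul/cocycle_inv.
have Da g h : a g h = cmul q b g h by rewrite /cmul divfK ?bP.1.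
have psia g h : comm_coc (psi a) g h = comm_coc (psi q) g h * comm_coc (psi b) g h.
  by rewrite -psi_commM //; apply: psi_comm_ext => //; apply: cocycle_mul.
have Dq g h : comm_coc a g h = comm_coc q g h * comm_coc b g h.
  by rewrite -comm_cocM /comm_coc !Da.
have b0 g h : comm_coc b g h != 0 by rewrite mulf_neq0 ?invr_eq0 ?bP.1.
have pb0 g h : comm_coc (psi b) g h != 0 by rewrite mulf_neq0 ?invr_eq0 ?(psi_coc bP).1.
have [q_psi psi_q] := psi_comm1 qP; split=> E g h.
  rewrite psia q_psi ?mul1r // => g' h'; apply: (mulIf (b0 g' h')).
  by rewrite mul1r -Dq.
rewrite Dq psi_q ?mul1r // => g' h'; apply: (mulIf (pb0 g' h')).
by rewrite mul1r -psia.
Qed.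

Lemma psi_commX a n g h : cocycle a ->
  comm_coc (psi (fun x y => a x y ^+ n)) g h = comm_coc (psi a) g h ^+ n.
Proof.
move=> aP; elim: n => [|n IHn].
  rewrite (psi_comm1 (cocycle_exp 0 aP)).1 // => x y.
  by rewrite /comm_coc !expr0 divr1.
rewrite exprS -IHn -psi_commM //; last exact: cocycle_exp.
apply: psi_comm_ext => [||x y]; try exact: cocycle_exp.
  by apply/cocycle_mul/cocycle_exp.
by rewrite /cmul exprS.
Qed.

(** Triviality of the commutator form, applied to the n-th power of [a]. *)
Lemma psi_comm_unity a n : cocycle a ->
  (forall g h, comm_coc a g h ^+ n = 1) <-> (forall g h, comm_coc (psi a) g h ^+ n = 1).
Proof.
move=> aP; have [E1 E2] := psi_comm1 (cocycle_exp n aP).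
have powE (T : finGroupType) (b : T -> T -> F) g h :
  comm_coc (fun x y => b x y ^+ n) g h = comm_coc b g h ^+ n.
  by rewrite /comm_coc -exprVn -exprMn.
split=> E g h; first by rewrite -psi_commX // E1 // => x y; rewrite powE.
by rewrite -powE E2 // => x y; rewrite psi_commX.
Qed.

End PsiComm.

(** * Counting alternating bicharacters *)

Section Alternating.
Variables (F : fieldType) (gT : finGroupType) (B : gT -> gT -> F).
Hypothesis altB : alternating B.

Lemma alternating_sym g h : B g h * B h g = 1.
Proof.
have [Ml Mr B1] := altB; have := B1 (g * h)%g.
by rewrite Ml !Mr !B1 mul1r mulr1 mulrC.
Qed.

Lemma alternating_neq0 g h : B g h != 0.
Proof.
apply: contra_eq_neq (alternating_sym g h) => ->.
by rewrite mul0r eq_sym oner_neq0.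
Qed.

Lemma alternating1l h : B 1%g h = 1.
Proof.
have [Ml _ _] := altB; apply: (mulfI (alternating_neq0 1 h)).
by rewrite -Ml mulg1 mulr1.
Qed.

Lemma alternatingXl g h n : B (g ^+ n)%g h = B g h ^+ n.
Proof.
have [Ml _ _] := altB.
by elim: n => [|n IHn]; rewrite ?alternating1l // expgS exprS Ml IHn.
Qed.

Lemma alternating_prodl (I : Type) (s : seq I) (u : I -> gT) h :
  B (\prod_(i <- s) u i)%g h = \prod_(i <- s) B (u i) h.
Proof.
have [Ml _ _] := altB; elim: s => [|i s IHs]; first by rewrite !big_nil alternating1l.
by rewrite !big_cons Ml IHs.
Qed.

End Alternating.

Lemma alternating_eq (F : fieldType) (gT : finGroupType) (b : seq gT)
    (X : nat -> gT -> nat) (B C : gT -> gT -> F) :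
  coordinates [set: gT] b X -> alternating B -> alternating C ->
  (forall i j, (i < j < size b)%N ->
     B (nth 1%g b i) (nth 1%g b j) = C (nth 1%g b i) (nth 1%g b j)) ->
  forall g h, B g h = C g h.
Proof.
case=> _ _ _ Xg altB altC BC.
have symB g h : B g h = (B h g)^-1.
  apply: (mulIf (alternating_neq0 altB h g)).
  by rewrite alternating_sym // mulVf ?alternating_neq0.
have symC g h : C g h = (C h g)^-1.
  apply: (mulIf (alternating_neq0 altC h g)).
  by rewrite alternating_sym // mulVf ?alternating_neq0.
have BCb i j : (i < size b)%N -> (j < size b)%N ->
    B (nth 1%g b i) (nth 1%g b j) = C (nth 1%g b i) (nth 1%g b j).
  move=> ib jb; have [ij|ji|->] := ltngtP i j; first by rewrite BC ?ij.
    by rewrite symB symC BC ?ji.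
  by case: altB altC => [_ _ ->] [_ _ ->].
have BCl g h : (forall j, (j < size b)%N -> B (nth 1%g b j) h = C (nth 1%g b j) h) ->
    B g h = C g h.
  move=> E; rewrite (Xg g) ?inE // !alternating_prodl //; apply: eq_bigr => i _.
  by rewrite !alternatingXl // E.
move=> g h; apply: (BCl) => j jb; rewrite symB symC; congr (_^-1).
by apply: BCl => i ib; apply: BCb.
Qed.

(** * Bilinear cocycles realising alternating bicharacters *)

Section BilinearCocycle.
Variables (F : fieldType) (gT : finGroupType) (cG : abelian [set: gT]).
Variables (b : seq gT) (X : nat -> gT -> nat) (bX : coordinates [set: gT] b X).
Variables (n : nat) (w : F) (wn : n.-primitive_root w).
Local Notation r := (size b).
Implicit Types c : {ffun 'I_r * 'I_r -> 'I_n}.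

(* Structure constants, on the pairs i < j of basis vectors, of the alternating
   maps from G x G to the n-th roots of unity. *)
Definition alt_coefs : {set {ffun 'I_r * 'I_r -> 'I_n}} :=
  [set c in family (fun ij : 'I_r * 'I_r => [pred t : 'I_n |
    if (ij.1 < ij.2)%N then (n %| t * #[nth 1 b ij.1]%g)%N && (n %| t * #[nth 1 b ij.2]%g)%N
    else t == 0%N :> nat])].

(** For [c] in [alt_coefs] this is the bilinear form with strictly upper triangular matrix [c],
    hence a cocycle. Its commutator form has the same entries above the diagonal, so every
    alternating form arises, also at the prime 2. *)
Definition bilin_coc c (g h : gT) : F :=
  \prod_(ij : 'I_r * 'I_r) w ^+ (c ij * (X ij.1 g * X ij.2 h)).

Lemma alt_coefsP c : c \in alt_coefs -> forall ij : 'I_r * 'I_r,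
  (n %| c ij * #[nth 1 b ij.1]%g)%N && (n %| c ij * #[nth 1 b ij.2]%g)%N.
Proof.
rewrite inE => /familyP cP ij; have := cP ij; rewrite inE.
by case: ifP => // _ /eqP->; rewrite !mul0n dvdn0.
Qed.

(** Coordinates are defined only modulo orders of basis elements; the divisibility conditions on
    coefficients absorb this ambiguity. *)
Let exprE (c : nat) m x y : (n %| c * m)%N -> x = y %[mod m] ->
  w ^+ (c * x) = w ^+ (c * y).
Proof.
move=> cm xy; apply/eqP; rewrite (eq_prim_root_expr wn).
wlog le_xy : x y xy / (x <= y)%N.
  by case/orP: (leq_total x y) => le W; [|rewrite eq_sym]; apply: W.
rewrite eq_sym eqn_mod_dvd ?leq_mul2l ?le_xy ?orbT // -mulnBr.
apply: dvdn_trans cm _; apply: dvdn_mul => //.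
by rewrite -eqn_mod_dvd //; apply/eqP.
Qed.

Lemma bilin_cocMl c g h k : c \in alt_coefs ->
  bilin_coc c (g * h)%g k = bilin_coc c g k * bilin_coc c h k.
Proof.
move=> cT; rewrite -big_split; apply: eq_bigr => ij _ /=.
have /andP[ci _] := alt_coefsP cT ij; have [_ XM _ _] := bX.
rewrite -exprD -mulnDr -mulnDl ![(X ij.1 _ * _)%N]mulnC ![(_ * X ij.2 k)%N]mulnC !mulnA.
apply: (@exprE _ #[nth 1 b ij.1]%g); last by apply: XM; rewrite inE.
by rewrite mulnAC dvdn_mulr.
Qed.

Lemma bilin_cocMr c g h k : c \in alt_coefs ->
  bilin_coc c g (h * k)%g = bilin_coc c g h * bilin_coc c g k.
Proof.
move=> cT; rewrite -big_split; apply: eq_bigr => ij _ /=.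
have /andP[_ cj] := alt_coefsP cT ij; have [_ XM _ _] := bX.
rewrite -exprD -mulnDr -mulnDr !mulnA.
apply: (@exprE _ #[nth 1 b ij.2]%g); last by apply: XM; rewrite inE.
by rewrite mulnAC dvdn_mulr.
Qed.

Lemma bilin_coc_neq0 c g h : bilin_coc c g h != 0.
Proof.
apply/prodf_neq0 => ij _; rewrite expf_neq0 // (prim_root_eq0 wn) -lt0n.
exact: prim_order_gt0 wn.
Qed.

Lemma bilin_coc_cocycle c : c \in alt_coefs -> cocycle (bilin_coc c).
Proof.
move=> cT; split=> g h *; first exact: bilin_coc_neq0.
by rewrite bilin_cocMl // bilin_cocMr // mulrA mulrC.
Qed.

Lemma bilin_cocX c g h : bilin_coc c g h ^+ n = 1.
Proof.
by rewrite -prodrXl big1 // => ij _; rewrite exprAC (prim_expr_order wn) expr1n.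
Qed.

Lemma comm_bilin_cocX c g h : comm_coc (bilin_coc c) g h ^+ n = 1.
Proof. by rewrite /comm_coc exprMn exprVn !bilin_cocX divr1. Qed.

Lemma bilin_coc_basis c (i j : 'I_r) : c \in alt_coefs ->
  bilin_coc c (nth 1%g b i) (nth 1%g b j) = w ^+ c (i, j).
Proof.
move=> cT; have [_ _ Xb _] := bX.
have E (ij : 'I_r * 'I_r) :
    w ^+ (c ij * (X ij.1 (nth 1%g b i) * X ij.2 (nth 1%g b j))) =
    w ^+ (c ij * ((ij.1 == i) * (ij.2 == j))).
  have /andP[ck cl] := alt_coefsP cT ij; rewrite !mulnA.
  rewrite (@exprE _ #[nth 1 b ij.2]%g _ (ij.2 == j)) ?Xb //; last first.
    by rewrite mulnAC dvdn_mulr.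
  rewrite mulnAC (@exprE _ #[nth 1 b ij.1]%g _ (ij.1 == i)) ?Xb //; last first.
    by rewrite mulnAC dvdn_mulr.
  by rewrite mulnAC.
rewrite /bilin_coc (eq_bigr _ (fun ij _ => E ij)) (bigD1 (i, j)) //= big1.
  by rewrite !eqxx !muln1 mulr1.
by case=> k l; rewrite xpair_eqE mulnb => /negPf->; rewrite muln0.
Qed.

Lemma comm_bilin_basis c (i j : 'I_r) : c \in alt_coefs -> (i < j)%N ->
  comm_coc (bilin_coc c) (nth 1%g b i) (nth 1%g b j) = w ^+ c (i, j).
Proof.
move=> cT ij; rewrite /comm_coc !bilin_coc_basis //.
move: (cT); rewrite inE => /familyP/(_ (j, i)); rewrite inE /= ltnNge ltnW //=.
by move/eqP->; rewrite divr1.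
Qed.

Lemma comm_bilin_inj c c' : c \in alt_coefs -> c' \in alt_coefs ->
  (forall g h, comm_coc (bilin_coc c) g h = comm_coc (bilin_coc c') g h) -> c = c'.
Proof.
move=> cT cT' E; apply/ffunP => -[i j]; apply: val_inj.
have [ij|ji] := ltnP i j; last first.
  move: cT cT'; rewrite !inE => /familyP/(_ (i, j)) + /familyP/(_ (i, j)).
  by rewrite !inE /= ltnNge ji /= => /eqP-> /eqP->.
have /eqP := E (nth 1%g b i) (nth 1%g b j).
rewrite !comm_bilin_basis // (eq_prim_root_expr wn) !modn_small //.
by move/eqP.
Qed.

(** The coefficients are logarithms to base [w] of the values of [B] on basis pairs. With
    injectivity, [alt_coefs] counts the alternating bicharacters with values in the n-th roots of
    unity. *)
Lemma comm_bilin_surj (B : gT -> gT -> F) : alternating B ->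
  (forall g h, B g h ^+ n = 1) ->
  exists2 c, c \in alt_coefs & forall g h, comm_coc (bilin_coc c) g h = B g h.
Proof.
move=> altB Bn; pose k g h := sval (prim_rootP wn (Bn g h)).
have Dk g h : B g h = w ^+ k g h by rewrite /k; case: prim_rootP.
have n0 := prim_order_gt0 wn.
pose c := [ffun ij : 'I_r * 'I_r => if (ij.1 < ij.2)%N
  then k (nth 1%g b ij.1) (nth 1%g b ij.2) else Ordinal n0].
(* A value of [B] on a basis pair is killed by the orders of both basis elements, by bilinearity in
   the first variable and symmetry up to inversion. *)
have cT : c \in alt_coefs.
  rewrite inE; apply/familyP => -[i j]; rewrite inE ffunE /=.
  case: ifP => ij; rewrite ij // !(prim_order_dvd wn) !exprM -Dk.
  rewrite -alternatingXl // expg_order alternating1l // eqxx /=.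
  apply/eqP/(mulIf (alternating_neq0 altB (nth 1%g b j ^+ #[nth 1 b j]%g)%g (nth 1%g b i))).
  rewrite {1}alternatingXl // -exprMn alternating_sym // expr1n.
  by rewrite expg_order alternating1l // mul1r.
exists c => //; apply: (alternating_eq bX) => // [|i j /andP[ij jr]].
  exact/(comm_coc_alternating cG)/bilin_coc_cocycle.
have ir := ltn_trans ij jr.
by rewrite (@comm_bilin_basis c (Ordinal ir) (Ordinal jr)) // ffunE /= ij -Dk.
Qed.

End BilinearCocycle.

(** Stated for a relation, because the correspondence it serves passes through the choice of a
    cocycle. *)
Lemma card_rel_le (T1 T2 : finType) (A : {set T1}) (B : {set T2}) (R : T1 -> T2 -> Prop) :
  (forall x, x \in A -> exists2 y, y \in B & R x y) ->
  (forall x x' y, x \in A -> x' \in A -> y \in B -> R x y -> R x' y -> x = x') ->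
  (#|A| <= #|B|)%N.
Proof.
move=> Rtot Rinj; have [->|[x0 x0A]] := set_0Vmem A; first by rewrite cards0.
have [y0 y0B _] := Rtot x0 x0A.
have /(fin_all_exists (P := fun x y => x \in A -> y \in B /\ R x y))[f fP] :
    forall x, exists y, x \in A -> y \in B /\ R x y.
  move=> x; have [xA|xA] := boolP (x \in A); last by exists y0.
  by have [y yB xy] := Rtot x xA; exists y.
rewrite -(card_in_imset (f := f)) => [|x x' xA x'A fxx'].
  by apply/subset_leq_card/subsetP => _ /imsetP[x xA ->]; have [] := fP x xA.
have [fxB Rx] := fP x xA; have [_ Rx'] := fP x' x'A.
by apply: (Rinj x x' (f x)) => //; rewrite fxx'.
Qed.

Lemma card_alt_coefs_sim (F : fieldType) (gT hT : finGroupType)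
    (cG : abelian [set: gT]) (cH : abelian [set: hT])
    (b : seq gT) (b' : seq hT) X X' (n : nat) (w : F) :
  sim_F F gT hT -> n.-primitive_root w ->
  coordinates [set: gT] b X -> coordinates [set: hT] b' X' ->
  #|alt_coefs b n| = #|alt_coefs b' n|.
Proof.
move=> [psi [[psi_coc psi_coh psiM psi_inj psi_surj] psi_iso]] wn bX bX'.
have psi_eq := psi_comm_eq cG cH psi_coc psi_coh psiM psi_iso.
have psi_unity := psi_comm_unity cG cH psi_coc psi_coh psiM psi_iso.
(* Two matrices correspond when some cocycle has the first as commutator form and its image under
   [psi] has the second. *)
pose R (c : {ffun 'I_(size b) * 'I_(size b) -> 'I_n})
       (c' : {ffun 'I_(size b') * 'I_(size b') -> 'I_n}) :=
  exists2 a, cocycle a & (forall g h, comm_coc a g h = comm_coc (bilin_coc X w c) g h) /\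
    (forall g h, comm_coc (psi a) g h = comm_coc (bilin_coc X' w c') g h).
have RP c c1 c' c1' : c \in alt_coefs b n -> c1 \in alt_coefs b n ->
    c' \in alt_coefs b' n -> c1' \in alt_coefs b' n ->
    R c c' -> R c1 c1' -> c = c1 <-> c' = c1'.
  move=> cT c1T cT' c1T' [a aP [ac ac']] [a1 a1P [a1c a1c']].
  have [E1 E2] := psi_eq _ _ aP a1P; split=> E.
    apply: (comm_bilin_inj bX' wn) => // g h.
    by rewrite -ac' -a1c'; apply: E1 => x y; rewrite ac a1c E.
  apply: (comm_bilin_inj bX wn) => // g h.
  by rewrite -ac -a1c; apply: E2 => x y; rewrite ac' a1c' E.
apply/eqP; rewrite eqn_leq; apply/andP; split.
  apply: (card_rel_le (R := R)) => [c cT|c c1 c' cT c1T cT' cR c1R]; last first.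
    exact: (RP c c1 c' c' _ _ _ _ cR c1R).2.
  have aP := bilin_coc_cocycle bX wn cT.
  have [||c' cT' Ec'] := comm_bilin_surj cH bX' wn (B := comm_coc (psi (bilin_coc X w c))).
  - exact/(comm_coc_alternating cH)/psi_coc.
  - by apply/(psi_unity _ n aP) => g h; apply: comm_bilin_cocX.
  exists c' => //; exists (bilin_coc X w c) => //.
  by split=> // g h; rewrite Ec'.
apply: (card_rel_le (R := fun c' c => R c c')) => [c' cT'|c c1 c' cT c1T cT' cR c1R]; last first.
  exact: (RP c' c' c c1 _ _ _ _ cR c1R).1.
have aP' := bilin_coc_cocycle bX' wn cT'.
have [a aP aE] := psi_surj _ aP'.
have Da g h : comm_coc (psi a) g h = comm_coc (bilin_coc X' w c') g h.
  by rewrite (comm_coc_cohom cH _ aE) //; case: (psi_coc a aP).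
have [||c cT Ec] := comm_bilin_surj cG bX wn (B := comm_coc a).
- exact: comm_coc_alternating.
- by apply/(psi_unity _ n aP) => g h; rewrite Da; apply: comm_bilin_cocX.
by exists c => //; exists a => //; split=> // g h; rewrite Ec.
Qed.

(** * Conjugate partitions *)

Section ConjugatePartition.
Local Open Scope nat_scope.
Implicit Types (v : seq nat) (m : nat -> nat).

(** The conjugate partition, indexed from 0. On the p-adic valuations of the invariants of a group,
    it counts the invariants divisible by [p ^ l.+1]. *)
Definition conj_part v l := count (fun x => l < x) v.

Lemma conj_part_le v l k : l <= k -> conj_part v k <= conj_part v l.
Proof. by move=> lk; apply: sub_count => x; apply: leq_ltn_trans. Qed.

Lemma conj_part_nth v l j : sorted geq v -> (l < nth 0 v j) = (j < conj_part v l).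
Proof.
elim: v j => [|x v IHv] j /=; first by rewrite nth_nil.
move=> xv; have sv := path_sorted xv; rewrite /conj_part /=.
have [lx|xl] := ltnP l x; first by case: j => [|j] /=; rewrite ?lx // IHv.
have v0 : count (fun y => l < y) v = 0.
  apply/eqP; rewrite -leqn0 leqNgt -has_count; apply/hasPn => y yv.
  rewrite -leqNgt; apply: leq_trans xl.
  by have /allP/(_ y yv) := order_path_min (rev_trans leq_trans) xv.
rewrite v0 ltn0; apply/negbTE; rewrite -leqNgt.
case: j => [|j] //=; rewrite leqNgt IHv // /conj_part v0 //.
Qed.

Lemma minn_sum k x : minn k x = \sum_(l < k) (l < x).
Proof.
elim: k => [|k IHk]; first by rewrite min0n big_ord0.
by rewrite big_ord_recr /= -IHk; lia.
Qed.

Lemma sum_minn v k : \sum_(j < size v) minn k (nth 0 v j) = \sum_(l < k) conj_part v l.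
Proof.
under eq_bigr => j _ do rewrite minn_sum.
rewrite exchange_big; apply: eq_bigr => l _ /=.
rewrite /conj_part -sum1_count (big_nth 0) big_mkord [RHS]big_mkcond.
by apply: eq_bigr => j _; case: ltnP.
Qed.

(** Column [l] of the Young diagram occupies the rows below [conj_part v l], and the indices of
    these rows, from 0, sum to a binomial coefficient. *)
Lemma sum_mul_minn v k : sorted geq v ->
  \sum_(j < size v) j * minn k (nth 0 v j) = \sum_(l < k) 'C(conj_part v l, 2).
Proof.
move=> sv; under eq_bigr => j _ do rewrite minn_sum big_distrr.
rewrite exchange_big; apply: eq_bigr => l _ /=.
under eq_bigr => j _ do rewrite conj_part_nth // mulnC mulnbl.
rewrite -big_mkcond -bin2_sum big_mkord.
by rewrite (big_ord_widen_cond _ xpredT id (count_size _ v)).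
Qed.

Lemma bin2_eq x y : 'C(x, 2) = 'C(y, 2) -> x = y \/ x <= 1 /\ y <= 1.
Proof.
wlog xy : x y / x <= y => [W|] E.
  case/orP: (leq_total x y) => le; first exact: W.
  by have := W y x le (esym E); lia.
have [y1|y1] := leqP y 1; first by right; lia.
left; apply/eqP; rewrite eqn_leq xy leqNgt; apply/negP => ltxy.
suff : 'C(x, 2) < 'C(y, 2) by rewrite E ltnn.
have [x0|x0] := posnP x; first by rewrite x0 bin0n bin_gt0.
have := leq_bin2l 2 ltxy; rewrite binS bin1; lia.
Qed.

(* The sequences m and m' can only differ where both take values in {0, 1};
   being nonincreasing, one of them then dominates the other everywhere. *)
Lemma bin2_sum_eq m m' K :
  (forall l k, l <= k -> m k <= m l) -> (forall l k, l <= k -> m' k <= m' l) ->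
  (forall l, l < K -> 'C(m l, 2) = 'C(m' l, 2)) ->
  \sum_(l < K) m l = \sum_(l < K) m' l -> forall l, l < K -> m l = m' l.
Proof.
suff W m1 m2 : (forall l k, l <= k -> m1 k <= m1 l) -> (forall l k, l <= k -> m2 k <= m2 l) ->
    (forall l, l < K -> 'C(m1 l, 2) = 'C(m2 l, 2)) ->
    \sum_(l < K) m1 l = \sum_(l < K) m2 l -> forall l, l < K -> m2 l <= m1 l.
  move=> dm dm' E S l lK; apply/eqP; rewrite eqn_leq; apply/andP; split.
    by apply: (W m' m) => // k kK; rewrite E.
  exact: (W m m').
move=> d1 d2 E S l lK; rewrite leqNgt; apply/negP => lt12.
have [|[m1l m2l]] := bin2_eq (E l lK); first by move=> e; rewrite e ltnn in lt12.
have le12 (j : 'I_K) : m1 j <= m2 j.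
  have [lj|jl] := leqP l j; first by have := d1 _ _ lj; lia.
  have := d2 _ _ (ltnW jl).
  by have [->|[]] := bin2_eq (E j (ltn_ord j)); lia.
suff : \sum_(j < K) m1 j < \sum_(j < K) m2 j by rewrite S ltnn.
rewrite (bigD1 (Ordinal lK)) //= [ltnRHS](bigD1 (Ordinal lK)) //=.
by rewrite -addSn leq_add // leq_sum.
Qed.

(** * Recovering the conjugate partition from binomials and partial sums *)

Variables (m m' : nat -> nat) (root : nat -> Prop) (e M : nat).
Hypotheses (dm : forall l k, l <= k -> m k <= m l).
Hypotheses (dm' : forall l k, l <= k -> m' k <= m' l).
Hypotheses (m0 : forall l, e <= l -> m l = 0) (m'0 : forall l, M <= l -> m' l = 0).
Hypothesis eM : e <= M.
Hypothesis root0 : root 0.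
Hypothesis rootS : forall k, root k.+1 -> root k.
Hypothesis binS : forall k, root k ->
  \sum_(l < k) 'C(m l, 2) = \sum_(l < k) 'C(m' l, 2).
Hypothesis sumM : \sum_(l < M) m l = \sum_(l < M) m' l.
Hypothesis sumE : forall k k0, root k0 -> ~ root k0.+1 -> k0 <= k <= e ->
  k0 < e -> \sum_(l < k) m l = \sum_(l < k) m' l.

Let root_le k l : k <= l -> root l -> root k.
Proof. by elim: l => [|l IHl]; [case: k | rewrite leq_eqVlt => /predU1P[->|/IHl le /rootS]]. Qed.

Let bin_eq k l : root k -> l < k -> 'C(m l, 2) = 'C(m' l, 2).
Proof.
move=> rk lk; have rl := root_le lk rk.
have := binS rl; rewrite !big_ord_recr /= binS; last exact: rootS.
by move/addnI.
Qed.

Lemma conj_part_eq l : m l = m' l.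
Proof.
(* Once the sequences agree up to some [k >= e], beyond which [m] vanishes, equality of the totals
   forces [m'] to vanish there too. *)
have tail k : k <= M -> (forall j, j < k -> m j = m' j) -> e <= k -> m =1 m'.
  move=> kM E ek j; have [jk|kj] := ltnP j k; first exact: E.
  have [jM|Mj] := ltnP j M; last by rewrite m'0 // m0 // (leq_trans eM).
  rewrite m0 ?(leq_trans ek) //.
  have : \sum_(l < k) m l = \sum_(l < M) m l.
    rewrite (big_ord_widen _ m kM) [RHS](bigID (fun i : 'I_M => i < k)) /=.
    by rewrite [X in _ = _ + X]big1 ?addn0 // => i; rewrite -leqNgt => /(leq_trans ek)/m0.
  rewrite sumM (eq_bigr (fun i : 'I_k => m' i)) => [|i _]; last exact: E.
  rewrite (big_ord_widen _ m' kM) [RHS](bigID (fun i : 'I_M => i < k)) /=.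
  move/eqP; rewrite -[X in X == _]addn0 eqn_add2l eq_sym sum_nat_eq0 => /forall_inP.
  by move/(_ (Ordinal jM)); rewrite -leqNgt => /(_ kj)/eqP.
case: (classic (root e)) => [re|nre].
  (* If [m'] is at most 1 from [e] on, the binomials agree up to [M] and the total decides.
     Otherwise [m'] is at least 2 below [e] by monotonicity, where the binomials determine the
     values. *)
  have [le1|] := boolP [forall j : 'I_M, (e <= j) ==> (m' j <= 1)].
    apply: (tail M) => //; apply: bin2_sum_eq => // j jM.
    have [je|ej] := ltnP j e; first exact: bin_eq re je.
    have /forallP/(_ (Ordinal jM))/implyP/(_ ej)/= := le1.
    by rewrite m0 //; case: (m' j) => [|[]].
  rewrite negb_forall => /existsP[j]; rewrite negb_imply -ltnNge => /andP[ej j2].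
  apply: (tail e) => // i ie.
  have [//|[_]] := bin2_eq (bin_eq re ie).
  by have := dm' (leq_trans (ltnW ie) ej); lia.
(* Let [k0] be the last level with a root of unity in [F]. Below [k0] the binomials and the sum up
   to [k0] suffice; from [k0] to [e] the values are differences of known partial sums. *)
have [k0 k0e [rk0 nrk0]] : exists2 k0, k0 < e & root k0 /\ ~ root k0.+1.
  apply: NNPP => nk; apply: nre; elim: {-2}e (leqnn e) => // k IHk ke.
  by apply: NNPP => nr; apply: nk; exists k => //; split=> //; apply/IHk/ltnW.
apply: (tail e) => // i ie; have [ik|ki] := ltnP i k0.
  apply: (bin2_sum_eq dm dm' (K := k0)) => // [j jk|]; first exact: bin_eq rk0 jk.
  by apply: (sumE rk0) => //; rewrite leqnn ltnW.
have k0i : k0 <= i.+1 <= e by rewrite ie leqW.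
have k0i' : k0 <= i <= e by rewrite ki ltnW.
have := sumE rk0 nrk0 k0i k0e.
by rewrite !big_ord_recr /= (sumE rk0 nrk0 k0i' k0e) => /addnI.
Qed.

End ConjugatePartition.

(** * Counting in terms of abelian types *)

Section Counting.
Local Open Scope group_scope.
Local Open Scope nat_scope.

(** The solutions are the multiples of [n %/ gcdn n s]. *)
Lemma card_ord_dvd_mul n s : 0 < n -> #|[pred t : 'I_n | n %| t * s]| = gcdn n s.
Proof.
move=> n0; set g := gcdn n s; have g0 : 0 < g by rewrite gcdn_gt0 n0.
have gn : g %| n by apply: dvdn_gcdl.
have dvdE t : (n %| t * s) = (n %/ g %| t).
  rewrite -{1}(divnK gn) -{1}(divnK (dvdn_gcdr n s)) -/g mulnA dvdn_pmul2r //.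
  rewrite Gauss_dvdl // /coprime -(eqn_pmul2r g0) mul1n muln_gcdl.
  by rewrite !divnK // dvdn_gcdr.
have d0 : 0 < n %/ g by rewrite divn_gt0 // dvdn_leq.
have lt_n (i : 'I_g) : i * (n %/ g) < n.
  by rewrite -[X in _ < X](divnK gn) mulnC ltn_pmul2l.
rewrite -[RHS](card_ord g) -(card_imset (f := fun i : 'I_g => Ordinal (lt_n i))).
  apply: eq_card => t; rewrite !inE dvdE; apply/idP/imsetP => [/dvdnP[q Dt]|[i _ ->]].
    have qg : q < g by rewrite -(ltn_pmul2r d0) -Dt mulnC divnK.
    by exists (Ordinal qg) => //; apply: val_inj.
  exact: dvdn_mull.
by move=> i j [/eqP]; rewrite eqn_pmul2r // => /eqP/val_inj.
Qed.

Lemma card_Ldiv_cycle (gT : finGroupType) (x : gT) n :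
  0 < n -> #|'Ldiv_n(<[x]>)| = gcdn n #[x].
Proof.
move=> n0; rewrite gcdnC -(card_ord_dvd_mul n (order_gt0 x)).
rewrite -(card_imset (f := fun i : 'I_#[x] => x ^+ i)%g).
  apply: eq_card => y; rewrite !inE; apply/andP/imsetP => [[/cyclePmin[i ix ->] yn]|[i + ->]].
    by exists (Ordinal ix); rewrite ?inE //= order_dvdn expgM.
  by rewrite inE order_dvdn expgM => xn; rewrite mem_cycle.
by move=> i j /eqP; rewrite eq_expg_mod_order !modn_small // => /eqP/val_inj.
Qed.

Lemma card_Ldiv_dprod (gT : finGroupType) (K H G : {group gT}) n :
  K \x H = G -> #|'Ldiv_n(G)| = #|'Ldiv_n(K)| * #|'Ldiv_n(H)|.
Proof.
move=> defG; have [_ mulKH cKH tiKH] := dprodP defG.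
rewrite -cardsX -(card_in_imset (f := fun u : gT * gT => (u.1 * u.2)%g)).
  apply: eq_card => y; apply/LdivP/imsetP => [[]|[[k h]]].
    rewrite -mulKH => /mulsgP[k h kK hH ->].
    have kh : commute k h by apply/commute_sym/(centsP cKH).
    rewrite expgMn // => khn; exists (k, h) => //=.
    have kn : (k ^+ n = 1)%g.
      have : (k ^+ n)%g \in K :&: H.
        rewrite inE groupX //=; have -> : (k ^+ n = (h ^+ n)^-1)%g.
          by apply/eqP; rewrite eq_mulgV1 invgK khn.
        by rewrite groupV groupX.
      by rewrite tiKH inE => /eqP.
    rewrite kn mul1g in khn; rewrite in_setX /=.
    by apply/andP; split; apply/LdivP.
  rewrite in_setX => /andP[/LdivP[kK kn] /LdivP[hH hn]] /= ->; split.
    by rewrite -mulKH mem_mulg.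
  by rewrite expgMn ?kn ?hn ?mulg1 //; apply/commute_sym/(centsP cKH).
move=> [k h] [k' h']; rewrite !in_setX /= => /andP[/LdivP[kK _] /LdivP[hH _]].
move=> /andP[/LdivP[k'K _] /LdivP[h'H _]] E.
congr pair; first by rewrite -[LHS](divgrMid tiKH kK hH) E divgrMid.
by rewrite -[LHS](remgrMid tiKH kK hH) E remgrMid.
Qed.

Lemma card_Ldiv_abelian (gT : finGroupType) (b : seq gT) (G : {group gT}) n :
  0 < n -> \big[dprod/1%g]_(x <- b) <[x]>%g = G ->
  #|'Ldiv_n(G)| = \prod_(x <- b) gcdn n #[x].
Proof.
move=> n0; elim: b G => [|x b IHb] G.
  rewrite !big_nil => <-; rewrite -(cards1 (1%g : gT)); apply: eq_card => y.
  by rewrite !inE; case: eqP => // ->; rewrite expg1n eqxx.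
rewrite !big_cons => defG; have [[_ H _ defH] _ _ _] := dprodP defG.
rewrite defH in defG; rewrite -(IHb H) // -card_Ldiv_cycle //.
exact: card_Ldiv_dprod.
Qed.

Lemma logn_prod (I : Type) (r : seq I) (f : I -> nat) p :
  (forall i, 0 < f i) -> logn p (\prod_(i <- r) f i) = \sum_(i <- r) logn p (f i).
Proof.
move=> f0; elim: r => [|i r IHr]; first by rewrite !big_nil logn1.
by rewrite !big_cons lognM ?IHr // prodn_gt0.
Qed.

Variables (gT : finGroupType) (cG : abelian [set: gT]) (p : nat).

(** Invariants prime to [p] remain as zeros, which [conj_part] does not count. *)
Definition log_type := map (logn p) (abelian_type [set: gT]).

Lemma log_type_sorted : sorted geq log_type.
Proof.
have := abelian_type_dvdn_sorted [set: gT]; have := abelian_type_gt1 [set: gT].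
rewrite /log_type; case: (abelian_type _) => //= x s.
elim: s x => //= y s IHs x /andP[x1 ys] /andP[yx sP].
by rewrite dvdn_leq_log ?IHs // ltnW.
Qed.

Lemma log_type_size : size log_type = size (abelian_type [set: gT]).
Proof. exact: size_map. Qed.

Lemma logn_card_Ldiv D : 0 < D ->
  logn p #|[set x : gT | (x ^+ D)%g == 1%g]| = \sum_(l < logn p D) conj_part log_type l.
Proof.
move=> D0; have [b defG Db] := abelian_structure cG.
have -> : [set x : gT | (x ^+ D)%g == 1%g] = 'Ldiv_D([set: gT]) by rewrite setTI.
rewrite (card_Ldiv_abelian D0 defG) logn_prod => [|x]; last by rewrite gcdn_gt0 D0.
rewrite -sum_minn -(big_mkord xpredT (fun j => minn _ (nth 0 log_type j))).
rewrite -(big_nth 0 xpredT (fun v => minn (logn p D) v)).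
rewrite /log_type -Db !big_map; apply: eq_bigr => x _.
by rewrite logn_gcd.
Qed.

(** For [i < j] the order of the j-th basis element divides that of the i-th, so the entry has
    [gcdn (p ^ k)] of the smaller order as number of choices. Each [j] occurs with [j] values of
    [i]. *)
Lemma logn_card_alt_coefs (b : seq gT) k :
  prime p -> map order b = abelian_type [set: gT] ->
  logn p #|alt_coefs b (p ^ k)| = \sum_(l < k) 'C(conj_part log_type l, 2).
Proof.
move=> p_pr Db; have pk0 : 0 < p ^ k by rewrite expn_gt0 prime_gt0.
rewrite cardsE card_family foldrE big_image /=.
pose u j := logn p (nth 1 (abelian_type [set: gT]) j).
have Du (j : 'I_(size b)) : u j = logn p #[nth 1%g b j].
  by rewrite /u -Db (nth_map 1%g).
have dvd_b (i j : 'I_(size b)) : i < j -> #[nth 1%g b j] %| #[nth 1%g b i].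
  move=> ij; have := abelian_type_dvdn_sorted [set: gT]; rewrite -Db.
  have tr : transitive [rel m n | n %| m] by move=> x y z /= yx /dvdn_trans; apply.
  move/(sorted_ltn_nth tr 1)/(_ i j); rewrite !inE size_map => /(_ _ _ ij).
  by rewrite !(nth_map 1%g) //=; apply.
rewrite (eq_bigr (fun ij : 'I_(size b) * 'I_(size b) =>
    if ij.1 < ij.2 then gcdn (p ^ k) #[nth 1%g b ij.2] else 1)) => [|[i j] _ /=]; last first.
  case: ifP => [ij|_]; last by rewrite -(card1 (Ordinal pk0)); apply: eq_card => t.
  rewrite -card_ord_dvd_mul //; apply: eq_card => t; rewrite !inE.
  by apply: andb_idl => /dvdn_trans; apply; apply/dvdn_mul/dvd_b.
rewrite big_mkcond logn_prod => [|ij]; last by case: ifP => // _; rewrite gcdn_gt0 pk0.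
rewrite -(pair_bigA _ (fun i j : 'I_(size b) =>
    logn p (if i < j then gcdn (p ^ k) #[nth 1%g b j] else 1))) /=.
rewrite exchange_big /= -(sum_mul_minn _ log_type_sorted) log_type_size -Db size_map.
apply: eq_bigr => j _; rewrite (nth_map 1) -?Db ?size_map // (nth_map 1%g) // -Du.
rewrite (eq_bigr (fun i : 'I_(size b) => if i < j then minn k (u j) else 0)); last first.
  move=> i _; case: ifP => _; last by rewrite logn1.
  by rewrite logn_gcd // pfactorK // Du.
rewrite -big_mkcond -(big_ord_widen _ (fun=> minn k (u j)) (ltnW (ltn_ord j))).
by rewrite sum_nat_const card_ord.
Qed.
End Counting.

(** * The isomorphism theorem *)

Lemma bijective_rmorphism (R S : nzRingType) (f : R -> S) : bijective f ->
  (forall x y, f (x + y) = f x + f y) -> (forall x y, f (x * y) = f x * f y) ->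
  exists (f' : {rmorphism R -> S}) (g' : {rmorphism S -> R}), cancel f' g' /\ cancel g' f'.
Proof.
case=> g fK gK fD fM.
have f0 : f 0 = 0 by apply: (addIr (f 0)); rewrite -fD !add0r.
have f1 : f 1 = 1 by rewrite -[LHS]mulr1 -[X in _ * X = _]gK -fM mul1r gK.
have gD x y : g (x + y) = g x + g y by apply: (can_inj fK); rewrite fD !gK.
have g0 : g 0 = 0 by apply: (addIr (g 0)); rewrite -gD !add0r.
have gM x y : g (x * y) = g x * g y by apply: (can_inj fK); rewrite fM !gK.
have g1 : g 1 = 1 by rewrite -f1 fK.
pose fm := GRing.isMonoidMorphism.Build R S f (conj f1 fM).
pose fz := GRing.isNmodMorphism.Build R S f (conj f0 fD).
pose gm := GRing.isMonoidMorphism.Build S R g (conj g1 gM).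
pose gz := GRing.isNmodMorphism.Build S R g (conj g0 gD).
pose f' : {rmorphism R -> S} := HB.pack f fz fm.
pose g' : {rmorphism S -> R} := HB.pack g gz gm.
by exists f', g'.
Qed.

(** The image under [psi] of the trivial cocycle is a coboundary, so rescaling the basis turns its
    twisted algebra into the group algebra. *)
Lemma sim_F_galg (F : fieldType) (gT hT : finGroupType)
    (cG : abelian [set: gT]) (cH : abelian [set: hT]) : sim_F F gT hT ->
  exists (f : {rmorphism galg F cG -> galg F cH}) (g : {rmorphism galg F cH -> galg F cG}),
    cancel f g /\ cancel g f.
Proof.
case=> psi [[psi_coc psi_coh psiM _ _] psi_iso].
pose one (g h : gT) : F := 1.
have oneP : cocycle one by split=> *; rewrite ?oner_eq0.
have [c0 _] := psi_coc _ oneP.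
have [b1 [b10 E1]] : cohom (psi one) (psi (cmul one one)).
  by apply: psi_coh => //; [apply: cocycle_mul | apply: cohom_refl => *; rewrite /cmul mulr1].
have [b2 [b20 E2]] := psiM _ _ oneP oneP.
(* The image of [1 * 1] is cohomologous both to the image of 1 and to its square; cancelling gives a
   trivialisation by [b]. *)
pose b h := b1 h * b2 h; have b0 h : b h != 0 by rewrite mulf_neq0.
have cE g h : psi one g h * b (g * h)%g = b g * b h.
  apply: (mulfI (c0 g h)); rewrite mulrA -[psi one g h * psi one g h]/(cmul _ _ g h).
  by rewrite E2 E1 /b; field; rewrite b10 b20.
have [f [fbij fD fM]] := psi_iso _ oneP.
pose t (y : {ffun hT -> F}) : galg F cH := [ffun h => y h * b h].
apply: (@bijective_rmorphism (galg F cG) (galg F cH) (t \o f)).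
- apply: (@bij_comp _ _ _ t f) fbij.
  exists (fun y : galg F cH => [ffun h => y h / b h] : {ffun hT -> F}) => y;
    by apply/ffunP => h; rewrite !ffunE ?mulfK ?divfK.
- by move=> x y /=; apply/ffunP => h; rewrite fD !ffunE mulrDl.
move=> x y /=; rewrite -[x * y]/(tga_mul one x y) fM; apply/ffunP => h.
rewrite ffunE tga_mulE [RHS]galg_mulE mulr_suml; apply: eq_bigr => g _.
rewrite !ffunE -mulrA -[X in X = _]mulrA -[RHS]mulrA; congr (_ * _).
by rewrite [RHS]mulrCA -cE mulKVg.
Qed.

(** The exponents [i] with [z ^+ i] in [E] are the multiples of the least positive one, [i0], so
    [D = N %/ i0] works. *)
Lemma subfield_exponent (F : fieldType) (L : fieldExtType F) N (z : L) (E : {subfield L}) :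
  N.-primitive_root z ->
  exists2 D, (0 < D)%N & forall i, (z ^+ i \in E) = (z ^+ i ^+ D == 1).
Proof.
move=> zN; have N0 := prim_order_gt0 zN.
have exi : exists i, (0 < i)%N && (z ^+ i \in E).
  by exists N; rewrite N0 (prim_expr_order zN) mem1v.
case: (ex_minnP exi) => i0 /andP[i00 Ei0] min_i0.
have memE i : (z ^+ i \in E) = (i0 %| i)%N.
  apply/idP/idP => [Ei|/dvdnP[k ->]]; last by rewrite mulnC exprM rpredX.
  rewrite /dvdn; have [//|r0] := posnP (i %% i0).
  suff : (i0 <= i %% i0)%N by rewrite leqNgt ltn_mod i00.
  apply: min_i0; rewrite r0 /=.
  have z0 k : z ^+ k != 0 by rewrite expf_neq0 // (prim_root_eq0 zN) -lt0n.
  have -> : z ^+ (i %% i0) = z ^+ i / (z ^+ i0) ^+ (i %/ i0).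
    by rewrite {2}(divn_eq i i0) exprD mulnC exprM mulrAC divff ?mul1r // -exprM.
  by apply: rpred_div => //; apply: rpredX.
have i0N : (i0 %| N)%N by rewrite -memE (prim_expr_order zN) mem1v.
have D0 : (0 < N %/ i0)%N by rewrite divn_gt0 // dvdn_leq.
exists (N %/ i0)%N => // i; rewrite memE -exprM -(prim_order_dvd zN).
by rewrite -[X in _ = (X %| _)%N](divnK i0N) [(i * _)%N]mulnC dvdn_pmul2l.
Qed.

Lemma logn_dvd_eq p D k : prime p -> (0 < D)%N -> (p ^ k %| D)%N -> ~~ (p ^ k.+1 %| D)%N ->
  logn p D = k.
Proof.
move=> p_pr D0; rewrite !pfactor_dvdn // -ltnNge ltnS => le ge.
by apply/eqP; rewrite eqn_leq le ge.
Qed.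

Lemma card_pchar_neq0 (F : fieldType) (gT : finGroupType) :
  (forall p : nat, p \in [pchar F] -> ~~ (p %| #|[set: gT]|)%N) -> #|gT|%:R != 0 :> F.
Proof.
move=> chG; rewrite natf_neq0_pchar; apply/pnatP; first by rewrite -cardsT cardG_gt0.
by move=> p _; apply: contraL => /chG; rewrite cardsT.
Qed.

(** Each invariant is recovered from its valuations. Padding with the default 1 loses nothing, since
    all invariants exceed 1. *)
Lemma abelian_type_eq (gT hT : finGroupType) :
  (forall p l, prime p -> conj_part (log_type gT p) l = conj_part (log_type hT p) l) ->
  abelian_type [set: gT] = abelian_type [set: hT].
Proof.
move=> E; set s := abelian_type _; set s' := abelian_type _.
have s1 (rT : finGroupType) j : (0 < nth 1%N (abelian_type [set: rT]) j)%N.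
  have [js|sj] := ltnP j (size (abelian_type [set: rT])); last by rewrite nth_default.
  exact: ltnW (allP (abelian_type_gt1 _) _ (mem_nth 1%N js)).
have log0 (rT : finGroupType) p j :
    nth 0%N (log_type rT p) j = logn p (nth 1%N (abelian_type [set: rT]) j).
  have [js|sj] := ltnP j (size (abelian_type [set: rT])).
    by rewrite (nth_map 1%N).
  by rewrite !nth_default ?size_map // logn1.
have nthE j : nth 1%N s j = nth 1%N s' j.
  apply: eqn_from_log; rewrite ?s1 // => p.
  have [p_pr|p_npr] := boolP (prime p); last by rewrite lognE [RHS]lognE (negPf p_npr).
  have ltE l : (l < logn p (nth 1%N s j))%N = (l < logn p (nth 1%N s' j))%N.
    by rewrite -!log0 !conj_part_nth ?log_type_sorted // E.
  apply/eqP; rewrite eqn_leq; apply/andP; split; rewrite leqNgt.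
    by rewrite ltE ltnn.
  by rewrite -ltE ltnn.
have size_le (rT rT' : finGroupType) :
    (forall j, nth 1%N (abelian_type [set: rT]) j = nth 1%N (abelian_type [set: rT']) j) ->
    (size (abelian_type [set: rT]) <= size (abelian_type [set: rT']))%N.
  move=> nE; rewrite leqNgt; apply/negP => lt.
  have := allP (abelian_type_gt1 _) _ (mem_nth 1%N lt).
  by rewrite /= nE nth_default.
apply: (eq_from_nth (x0 := 1%N)) => //; apply/eqP; rewrite eqn_leq !size_le //.
Qed.

Lemma conj_part_exponent (gT : finGroupType) (cG : abelian [set: gT]) p n l :
  (0 < n)%N -> (exponent [set: gT] %| n)%N -> (logn p n <= l)%N ->
  conj_part (log_type gT p) l = 0%N.
Proof.
move=> n0 en nl; have [b _ Db] := abelian_structure cG.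
apply/eqP; rewrite -leqn0 leqNgt -has_count; apply/hasPn => _ /mapP[k + ->].
rewrite -Db => /mapP[x _ ->]; rewrite -leqNgt; apply: leq_trans nl.
by rewrite dvdn_leq_log // (dvdn_trans _ en) // dvdn_exponent ?inE.
Qed.

Lemma map_prim_root (F : fieldType) (L : fieldExtType F) n (w : F) :
  n.-primitive_root w -> n.-primitive_root (w%:A : L).
Proof. by rewrite -(fmorph_primitive_root (in_alg L)). Qed.

Theorem theorem3p4 (F : fieldType) (gT hT : finGroupType) :
  abelian [set: gT] -> abelian [set: hT] ->
  (forall p : nat, p \in [pchar F] -> ~~ (p %| #|[set: gT]|)%N) ->
  (forall p n : nat, prime p -> (p ^ n %| exponent [set: gT])%N ->
     ~ (exists z : F, (p ^ n)%N.-primitive_root z) ->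
     forall (L : fieldExtType F) (zeta : L), (p ^ n)%N.-primitive_root zeta ->
       ~ (exists w : L, w \in <<1%VS; zeta>>%VS /\ (p ^ n.+1)%N.-primitive_root w)) ->
  sim_F F gT hT ->
  [set: gT] \isog [set: hT].
Proof.
move=> cG cH chG hypF simGH; rewrite eq_abelian_type_isog //; apply/eqP.
have cardG := card_pchar_neq0 chG.
have [f [g [fK gK]]] := sim_F_galg cG cH simGH.
have cardG0 : (0 < #|gT|)%N by rewrite -cardsT cardG_gt0.
have cardH0 : (0 < #|hT|)%N by rewrite -cardsT cardG_gt0.
(* Regularity passes from the group algebra of [G] to that of [H] and makes the order of [H]
   invertible. *)
have cardH : #|hT|%:R != 0 :> F.
  have [L [z zG]] := prim_root_extension cardG.
  apply: (gal_regular_card (cG := cH)) => a.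
  have [w Dw] := gal_regular (prim_root_separates (cG := cG) zG (dvdnn _)) (g a).
  by exists (f w); rewrite -[a in LHS]gK Dw !rmorphM gK.
(* The square provides roots of unity of order [p ^ e.+1] whenever [e > 0], one level beyond the
   exponent of [G]. *)
pose N := (#|gT| ^ 2 * #|hT|)%N.
have NF : N%:R != 0 :> F by rewrite natrM natrX mulf_neq0 ?expf_neq0.
have N0 : (0 < N)%N by rewrite muln_gt0 expn_gt0 cardG0.
have [L [z zN]] := prim_root_extension NF.
have GN : (#|gT| %| N)%N by rewrite dvdn_mulr // dvdn_exp.
have HN : (#|hT| %| N)%N by rewrite dvdn_mull.
have sepA := prim_root_separates (cG := cG) zN GN.
have sepB := prim_root_separates (cG := cH) zN HN.
have eG : (exponent [set: gT] %| #|gT|)%N by rewrite -cardsT exponent_dvdn.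
have eH : (exponent [set: hT] %| N)%N by apply: dvdn_trans HN; rewrite -cardsT exponent_dvdn.
have count_eq (E : {subfield L}) D : (0 < D)%N ->
    (forall i, (z ^+ i \in E) = (z ^+ i ^+ D == 1)) -> forall p,
    (\sum_(l < logn p D) conj_part (log_type gT p) l)%N =
    (\sum_(l < logn p D) conj_part (log_type hT p) l)%N.
  move=> D0 zE p; rewrite -!logn_card_Ldiv //.
  by rewrite (card_pow1_iso sepA sepB cardG cardH GN HN zN D0 zE fK gK).
apply: abelian_type_eq => p l p_pr.
pose e := logn p (exponent [set: gT]); pose M := logn p N.
have pX_gt0 k : (0 < p ^ k)%N by rewrite expn_gt0 prime_gt0.
apply: (@conj_part_eq _ _ (fun k => exists w : F, (p ^ k)%N.-primitive_root w) e M).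
- exact: conj_part_le.
- exact: conj_part_le.
- by move=> k; apply: conj_part_exponent; rewrite ?exponent_gt0.
- by move=> k; apply: conj_part_exponent.
- by rewrite dvdn_leq_log // (dvdn_trans eG).
- by exists 1; apply/forallP => -[[|//] i0]; rewrite unity_rootE expr1n eqxx.
- move=> k [w wP]; exists (w ^+ p).
  have pkS : (p ^ k %| p ^ k.+1)%N by rewrite dvdn_exp2l.
  by have := dvdn_prim_root wP pkS; rewrite expnS mulnK.
- move=> k [w wP].
  have [b defG Db] := abelian_structure cG; have [b' defH Db'] := abelian_structure cH.
  have [X bX] := coordinates_exist defG; have [X' bX'] := coordinates_exist defH.
  rewrite -(logn_card_alt_coefs k p_pr Db) -(logn_card_alt_coefs k p_pr Db').
  by rewrite (card_alt_coefs_sim cG cH simGH wP bX bX').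
- apply: (count_eq {:L}%AS N) => // i.
  by rewrite memvf exprAC (prim_expr_order zN) expr1n eqxx.
move=> k k0 [w wP] nroot /andP[k0k ke] k0e.
have pN j : (j <= e.+1)%N -> (p ^ j %| N)%N.
  move=> je; apply/dvdn_mulr; apply: dvdn_trans (dvdn_exp2r 2 eG).
  rewrite pfactor_dvdn ?expn_gt0 ?exponent_gt0 // lognX -/e.
  by move: k0e je; lia.
have primL j : (j <= e.+1)%N -> (p ^ j)%N.-primitive_root (z ^+ (N %/ p ^ j)).
  by move=> je; apply/(dvdn_prim_root zN)/pN.
have zetaP := primL k (leqW ke); set zeta := z ^+ _ in zetaP.
(* In both cases [E] contains a primitive root of order [p ^ k] but none of order [p ^ k.+1], so
   that [D] has p-adic valuation [k]. For [k = k0] this is the choice of [k0]; for [k > k0] it is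
   the hypothesis on [F]. *)
pose E : {subfield L} := if (k == k0) then 1%AS else <<1; zeta>>%AS.
have Ek : exists2 i, (p ^ k)%N.-primitive_root (z ^+ i) & z ^+ i \in E.
  rewrite /E; case: eqP => [->|_]; last by exists (N %/ p ^ k)%N => //; apply: memv_adjoin.
  have wL := map_prim_root L wP.
  have wN : (w%:A : L) ^+ N = 1.
    by apply/eqP; rewrite -(prim_order_dvd wL) pN // leqW // ltnW.
  have [i Di] := prim_rootP zN wN; exists i; rewrite -Di //.
  by rewrite memvZ // mem1v.
have Ek1 i : (p ^ k.+1)%N.-primitive_root (z ^+ i) -> z ^+ i \notin E.
  move=> zP; apply/negP; rewrite /E; case: eqP => [kk0|/eqP kk0].
    case/vlineP => c Dc; apply: nroot; exists c.
    by rewrite -(fmorph_primitive_root (in_alg L)) /= -Dc -kk0.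
  move=> zE; apply: (hypF p k p_pr _ _ L zeta zetaP); last by exists (z ^+ i).
    by rewrite pfactor_dvdn ?exponent_gt0.
  (* A root of order [p ^ k] in [F] with [k > k0] would have a power of order [p ^ k0.+1]. *)
  case=> w' w'P; apply: nroot; exists (w' ^+ (p ^ (k - k0.+1))).
  have lt_k : (k0 < k)%N by rewrite ltn_neqAle eq_sym kk0.
  have pk : (p ^ k0.+1 %| p ^ k)%N by rewrite dvdn_exp2l.
  have := dvdn_prim_root w'P pk; rewrite -{1}(subnK lt_k) expnD mulnK //.
have [D D0 zE] := subfield_exponent E zN.
have <- : logn p D = k.
  apply: logn_dvd_eq => //.
    have [i iP Ei] := Ek; rewrite (prim_order_dvd iP); by rewrite -zE.
  have kP := primL k.+1 (ke : (k.+1 <= e.+1)%N).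
  by rewrite (prim_order_dvd kP) -zE Ek1.
exact: (count_eq E).
Qed.
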